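(* Let $\{\omega_i\}_{i}$ be a regular partition of the plane $\Omega=\mathbb R^2$ into regular polygons, let the soil surface be the plane $z-z_0=\xi_bx^b=\xi_1x^1+\xi_2x^2$, and assume that its discretization is $$z_i-z_0=\xi_b\overline x_i^{\,b},$$ where $\overline x_i=(\overline x_i^{\,1},\overline x_i^{\,2})$ is the mass center of $\omega_i$, and that $\theta_i=\theta$ for all $i$. Then for every given value $h>0$ there is $\boldsymbol v\in\mathbb R^2$ such that the state $(h_i,\boldsymbol v_i)=(h,\boldsymbol v)$ for all $i$ is a stationary point of the semidiscrete system (without mass source) $$\sigma_i\frac{\rm d}{{\rm d}t}(\theta_i h_i)+\sum_{j\in\mathcal N(i)}l_{(i,j)}\,\theta h_{(i,j)}\,(v_n)_{(i,j)}=0,$$ $$\sigma_i\frac{\rm d}{{\rm d}t}(\theta_i h_i v_{a\,i})+\sum_{j\in\mathcal N(i)}l_{(i,j)}\,\theta h_{(i,j)}\,(v_a)_{(i,j)}(v_n)_{(i,j)}+\frac12\sum_{j\in\mathcal N(i)}l_{(i,j)}(w_j-w_i)\,\theta h^s_{(i,j)}\,(n_a)_{(i,j)}=-\sigma_i\mathcal K_i|\boldsymbol v_i|v_{a\,i},\quad a=1,2.$$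
   Context: Regular partition into regular polygons: an edge-to-edge tiling by congruent regular polygons. Summation over the repeated index $b=1,2$ is understood. $\sigma_i>0$ is the area of $\omega_i$; $\mathcal N(i)$ is the set of cells sharing a side with $\omega_i$; $l_{(i,j)}$ is the length of the common side of $\omega_i,\omega_j$ and $\boldsymbol n_{(i,j)}$ (components $(n_a)_{(i,j)}$) its unit normal pointing towards $\omega_j$. Each cell carries a water depth $h_i$, a velocity $\boldsymbol v_i=(v_{1\,i},v_{2\,i})$, a porosity $\theta_i\in(0,1]$ and a soil altitude $z_i$. $g>0$ is the gravitational acceleration, $w_i=g(z_i+h_i)$, $\mathcal K_i=\mathcal K(h_i,\theta_i)=\alpha_p h_i(1-\theta_i)+\theta_i\alpha_s$ with constants $\alpha_p,\alpha_s>0$. Interface values: $\boldsymbol v_{(i,j)}=(\boldsymbol v_i+\boldsymbol v_j)/2$ with components $(v_a)_{(i,j)}$; $(v_n)_{(i,j)}=\boldsymbol v_{(i,j)}\cdot\boldsymbol n_{(i,j)}$; $\theta h_{(i,j)}=\theta_ih_i$ if $(v_n)_{(i,j)}>0$ and $\theta h_{(i,j)}=\theta_jh_j$ if $(v_n)_{(i,j)}<0$ (when $(v_n)_{(i,j)}=0$, the products $\theta h_{(i,j)}(v_n)_{(i,j)}$ are $0$); $\theta h^s_{(i,j)}=\theta h_{(i,j)}$ if $(v_n)_{(i,j)}\neq0$; $=\theta_ih_i$ if $(v_n)_{(i,j)}=0$ and $w_i>w_j$; $=\theta_jh_j$ if $(v_n)_{(i,j)}=0$ and $w_i\le w_j$.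 A state is a stationary point if, as a time-independent function, it satisfies the system. *)

(* Defs.v *)
From HB Require Import structures.
From mathcomp Require Import all_boot all_order all_algebra.
From mathcomp Require Import all_classical all_reals all_analysis.
Import Order.TTheory GRing.Theory Num.Theory.
Import numFieldNormedType.Exports.

Set Implicit Arguments.
Unset Strict Implicit.
Unset Printing Implicit Defensive.

Local Open Scope classical_set_scope.
Local Open Scope ring_scope.

Section Plane.
Variable R : realType.

Definition dot (u v : 'rV[R]_2) : R := \sum_(b < 2) u 0 b * v 0 b.

(* The library norm on row vectors is the sup norm, hence this definition. *)
Definition enorm (u : 'rV[R]_2) : R := Num.sqrt (dot u u).

Definition cross (u v : 'rV[R]_2) : R := u 0 0 * v 0 1 - u 0 1 * v 0 0.

(* The unoriented angle, in [0, pi], between two nonzero vectors. *)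
Definition angle (u v : 'rV[R]_2) : R := acos (dot u v / (enorm u * enorm v)).

Definition segment (a b : 'rV[R]_2) : set 'rV[R]_2 :=
  [set x | exists2 t : R, 0 <= t <= 1 & x = a + t *: (b - a)].

Definition congruent (A B : set 'rV[R]_2) : Prop :=
  exists (Q : 'M[R]_2) (a : 'rV[R]_2),
    Q *m Q^T = 1%:M /\ B = [set x *m Q + a | x in A].

(* The product Lebesgue measure lives on R * R, the points of the plane are
   row vectors. *)
Definition point_of (p : R * R) : 'rV[R]_2 :=
  \row_(b < 2) (if b == 0 then p.1 else p.2).

Definition area (A : set 'rV[R]_2) : R :=
  fine ((lebesgue_measure \x lebesgue_measure)%E (point_of @^-1` A)).

Definition mass_center (A : set 'rV[R]_2) : 'rV[R]_2 :=
  \row_(b < 2) ((area A)^-1 *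
    Rintegral (lebesgue_measure \x lebesgue_measure)%E (point_of @^-1` A)
      (fun p => point_of p 0 b)).

(* Vertices are listed cyclically: the successor of k is [ordS k]. *)
Record polygon := Polygon {
  nb_sides : nat;
  vertex : 'I_nb_sides -> 'rV[R]_2 }.

Definition edge (p : polygon) (k : 'I_(nb_sides p)) : 'rV[R]_2 :=
  vertex (ordS k) - vertex k.

Definition side (p : polygon) (k : 'I_(nb_sides p)) : set 'rV[R]_2 :=
  segment (vertex k) (vertex (ordS k)).

Definition interior_angle (p : polygon) (k : 'I_(nb_sides p)) : R :=
  angle (vertex (ordS k) - vertex k) (vertex (ord_pred k) - vertex k).

(* The closed convex hull of the vertices; for polygons that are convex in the
   sense below, this is the closed region bounded by the sides. *)
Definition region (p : polygon) : set 'rV[R]_2 :=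
  [set x | exists w : 'I_(nb_sides p) -> R,
    [/\ forall k, 0 <= w k, \sum_k w k = 1 & x = \sum_k w k *: vertex k]].

(* Strictly convex, with the vertices listed counterclockwise: every other
   vertex lies strictly to the left of each oriented side. *)
Definition convex_polygon (p : polygon) : Prop :=
  (3 <= nb_sides p)%N /\
  forall k j : 'I_(nb_sides p), j != k -> j != ordS k ->
    0 < cross (edge k) (vertex j - vertex k).

Definition regular_polygon (p : polygon) : Prop :=
  [/\ convex_polygon p,
      forall k k' : 'I_(nb_sides p), enorm (edge k) = enorm (edge k') &
      forall k k' : 'I_(nb_sides p), interior_angle k = interior_angle k'].

End Plane.

Section Partition.
Variables (R : realType) (I : choiceType) (P : I -> polygon R).

Local Notation omega i := (region (P i)).

Definition edge_to_edge : Prop :=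
  forall i j, i != j ->
    [\/ omega i `&` omega j = set0,
        exists (k : 'I_(nb_sides (P i))) (k' : 'I_(nb_sides (P j))),
          vertex k = vertex k' /\ omega i `&` omega j = [set vertex k] |
        exists (k : 'I_(nb_sides (P i))) (k' : 'I_(nb_sides (P j))),
          side k = side k' /\ omega i `&` omega j = side k].

Definition regular_partition : Prop :=
  [/\ forall i, regular_polygon (P i),
      forall i j, congruent (omega i) (omega j),
      \bigcup_i omega i = setT,
      forall i j, i != j -> (omega i)° `&` (omega j)° = set0 &
      edge_to_edge].

Definition common_side (i j : I) (k : 'I_(nb_sides (P i))) : Prop :=
  exists k' : 'I_(nb_sides (P j)), side k = side k'.

Definition neighbors (i : I) : set I :=
  [set j | j != i /\ exists k, @common_side i j k].

(* In a regular partition, two neighbors have exactly one common side, so the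
   properties below determine its length and its normal; [get] picks them. *)
Definition side_length (i j : I) : R :=
  get [set l | exists2 k, @common_side i j k & l = enorm (edge k)].

(* "Pointing towards omega j" : omega j lies in the half-plane that is bounded
   by the line of the common side and into which the normal points. *)
Definition side_normal (i j : I) : 'rV[R]_2 :=
  get [set n | exists2 k, @common_side i j k &
    [/\ enorm n = 1, dot n (edge k) = 0 &
        forall y, omega j y -> 0 <= dot n (y - vertex k)]].

Definition cell_area (i : I) : R := area (omega i).

Definition cell_center (i : I) : 'rV[R]_2 := mass_center (omega i).

End Partition.

Section InterfaceValues.
Variables (R : realType) (I : choiceType) (P : I -> polygon R).
Variables (g : R) (theta z : I -> R) (h : I -> R) (v : I -> 'rV[R]_2).

Definition level (i : I) : R := g * (z i + h i).

Definition interface_velocity (i j : I) : 'rV[R]_2 := 2^-1 *: (v i + v j).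

Definition normal_velocity (i j : I) : R :=
  dot (interface_velocity i j) (side_normal P i j).

(* The value for a zero normal velocity is irrelevant: it only occurs
   multiplied by that velocity. *)
Definition theta_h (i j : I) : R :=
  if 0 < normal_velocity i j then theta i * h i
  else if normal_velocity i j < 0 then theta j * h j
  else 0.

Definition theta_hs (i j : I) : R :=
  if normal_velocity i j != 0 then theta_h i j
  else if level j < level i then theta i * h i
  else theta j * h j.

Definition mass_flux (i : I) : R :=
  \sum_(j \in neighbors P i)
    side_length P i j * theta_h i j * normal_velocity i j.

Definition momentum_flux (a : 'I_2) (i : I) : R :=
  \sum_(j \in neighbors P i)
    side_length P i j * theta_h i j * interface_velocity i j 0 a *
    normal_velocity i j.

Definition pressure_term (a : 'I_2) (i : I) : R :=
  2^-1 * \sum_(j \in neighbors P i)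
    side_length P i j * (level j - level i) * theta_hs i j *
    side_normal P i j 0 a.

End InterfaceValues.

Section System.
Variables (R : realType) (I : choiceType) (P : I -> polygon R).
Variables (g alpha_p alpha_s : R) (theta z : I -> R).

Definition friction (h theta_i : R) : R :=
  alpha_p * h * (1 - theta_i) + theta_i * alpha_s.

Definition is_solution (h : R -> I -> R) (v : R -> I -> 'rV[R]_2) : Prop :=
  forall (t : R) (i : I),
    [/\ derivable (fun s => theta i * h s i) t 1,
        cell_area P i * derive1 (fun s => theta i * h s i) t
          + mass_flux P theta (h t) (v t) i = 0 &
        forall a : 'I_2,
          derivable (fun s => theta i * h s i * v s i 0 a) t 1 /\
          cell_area P i * derive1 (fun s => theta i * h s i * v s i 0 a) t
            + momentum_flux P theta (h t) (v t) a i
            + pressure_term P g theta z (h t) (v t) a i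
          = - (cell_area P i * friction (h t i) (theta i)
               * enorm (v t i) * v t i 0 a)].

Definition stationary_point (h : I -> R) (v : I -> 'rV[R]_2) : Prop :=
  is_solution (fun _ => h) (fun _ => v).

End System.

(* Main.v *)
(** With [h] and [v] constant and [theta] constant, both convective sums are
    multiples of [\sum_j l_(i,j) n_(i,j)], which vanishes for a closed polygon,
    so only the pressure term has to balance the friction.

    In a regular polygon the mass center [o] is fixed by the rotation that maps
    each vertex to the next one, hence [o = m_k + kappa * rot e_k] for every side
    [e_k] with midpoint [m_k], with one [kappa > 0]. Congruent regular polygons
    have the same number of sides, side length and [kappa], so the centers of two
    neighbors are mirror images in the common side and [z_j - z_i] is
    [2 kappa l (xi . n_(i,j))]. The discrete divergence theorem then makes the
    pressure term a positive multiple of [xi], with a factor that is the same for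
    all cells, as is the area; so [v] can be taken to be a suitable nonpositive
    multiple of [xi].

    The regions being congruent with disjoint interiors, the partition is locally
    finite, so each side of a cell is shared with exactly one neighbor. The Lebesgue
    measure of the plane is invariant under isometries because an orthogonal
    matrix is a product of shears and reflections along the axes. *)
Require Import Defs.
From HB Require Import structures.
From mathcomp Require Import all_boot all_order all_algebra.
From mathcomp Require Import all_classical all_reals all_analysis.
From mathcomp Require Import measurable_realfun zify ring lra.
Import Order.TTheory GRing.Theory Num.Theory.
Import numFieldNormedType.Exports.

Set Implicit Arguments.
Unset Strict Implicit.
Unset Printing Implicit Defensive.

Local Open Scope classical_set_scope.
Local Open Scope ring_scope.

(** * Isometries and Lebesgue measure *)

Section MeasurePreserving.
Variable R : realType.
Local Notation mR := (measurableTypeR R).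
Local Notation mu2 := ((@lebesgue_measure R) \x (@lebesgue_measure R))%E.

(** Here [s] is [1] or [-1]. The intervals []a, b]] determine Lebesgue measure; for [s = -1] their
    preimages are half-open at the other end but have the same length. *)
Lemma lebesgue_measure_isometry (s c : R) (A : set mR) :
  s ^+ 2 = 1 -> measurable A ->
  lebesgue_measure ((fun y : mR => s * y + c : mR) @^-1` A) =
    lebesgue_measure A.
Proof.
move=> s1 mA.
have mf : measurable_fun [set: mR] (fun y : mR => s * y + c : mR).
  by apply: measurable_funD => //; exact: measurable_funM.
rewrite -[LHS]/(pushforward lebesgue_measure (fun y : mR => s * y + c : mR) A).
apply/esym; apply: lebesgue_measure_unique => // _ [[a b] _ <-] /=.
have /orP[/eqP->|/eqP->] : (s == 1) || (s == -1) by rewrite -sqrf_eq1 s1.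
- rewrite /pushforward (_ : _ @^-1` _ = `]a - c, b - c]%classic).
    rewrite !lebesgue_measure_itv/= !lte_fin ltrD2r -!EFinB.
    by congr (if _ then (_)%:E else _); lra.
  by apply/seteqP; split=> y /=; rewrite !in_itv/= => /andP[? ?]; apply/andP;
    split; lra.
- rewrite /pushforward (_ : _ @^-1` _ = `[c - b, c - a[%classic).
    rewrite !lebesgue_measure_itv/= !lte_fin ltrD2l ltrN2 -!EFinB.
    by congr (if _ then (_)%:E else _); lra.
  by apply/seteqP; split=> y /=; rewrite !in_itv/= => /andP[? ?]; apply/andP;
    split; lra.
Qed.

Definition measure_preserving (T : mR * mR -> mR * mR) : Prop :=
  measurable_fun setT T /\
  forall A, measurable A -> mu2 (T @^-1` A) = mu2 A.

Lemma measure_preserving_comp T U :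
  measure_preserving T -> measure_preserving U -> measure_preserving (T \o U).
Proof.
move=> [mT T2] [mU U2]; split; first exact: measurableT_comp.
move=> A mA; rewrite comp_preimage U2 ?T2//.
by rewrite -[X in measurable X]setTI; exact: mT.
Qed.

Lemma measure_preserving_swap : measure_preserving (fun p => (p.2, p.1)).
Proof.
have mswap : measurable_fun [set: mR * mR] (fun p : mR * mR => (p.2, p.1)).
  exact: measurable_fun_pair.
split=> // A mA.
rewrite -[LHS]/(pushforward mu2 (fun p : mR * mR => (p.2, p.1)) A).
apply/esym; apply: product_measure_unique => // B C mB mC.
transitivity (mu2 (C `*` B)); last by rewrite [LHS]product_measure1E// muleC.
by congr mu2; apply/seteqP; split=> -[x y] [].
Qed.

(** The product measure integrates the measures of the vertical sections, and on the section over
    [x] the map is the isometry [y |-> s * y + (t * x + c)] of the line. *)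
Lemma measure_preserving_shear (s t c : R) : s ^+ 2 = 1 ->
  measure_preserving (fun p => (p.1, s * p.2 + (t * p.1 + c))).
Proof.
move=> s1; split.
  apply: measurable_fun_pair => //.
  apply: measurable_funD; first exact: measurable_funM.
  apply: measurable_funD => //; exact: measurable_funM.
move=> A mA; apply: eq_integral => x _ /=.
rewrite -(@lebesgue_measure_isometry s (t * x + c) (xsection A x))//.
exact: measurable_xsection.
Qed.

Lemma measure_preserving_isometry (a b c d e f : R) :
  a ^+ 2 + b ^+ 2 = 1 -> c ^+ 2 + d ^+ 2 = 1 -> a * c + b * d = 0 ->
  measure_preserving (fun p => (a * p.1 + b * p.2 + e, c * p.1 + d * p.2 + f)).
Proof.
move=> ab cd orth.
pose E1 s t c' (p : mR * mR) : mR * mR := (p.1, s * p.2 + (t * p.1 + c')).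
pose E2 s t c' (p : mR * mR) : mR * mR := (s * p.1 + (t * p.2 + c'), p.2).
have pE1 s t c' : s ^+ 2 = 1 -> measure_preserving (E1 s t c').
  exact: measure_preserving_shear.
(* Horizontal shears are vertical ones conjugated by the swap of coordinates. *)
have pE2 s t c' : s ^+ 2 = 1 -> measure_preserving (E2 s t c').
  move=> s1; have S := measure_preserving_swap.
  exact: (measure_preserving_comp S (measure_preserving_comp (pE1 s t c' s1)
    S)).
have one : (1 : R) ^+ 2 = 1 by rewrite expr1n.
(* For [c = 0] orthogonality forces a diagonal matrix with entries [1] or [-1]. *)
have [c0|c0] := eqVneq c 0.
  have d2 : d ^+ 2 = 1 by move: cd; rewrite c0; lra.
  have b0 : b = 0 by apply/eqP; move: orth; rewrite c0 mulr0 add0r => /eqP;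
    rewrite mulf_eq0 => /orP[//|/eqP d0]; move: d2; rewrite d0; lra.
  have a2 : a ^+ 2 = 1 by move: ab; rewrite b0; lra.
  rewrite (_ : (fun _ => _) = E1 d 0 f \o E2 a 0 e).
    by apply: measure_preserving_comp; [exact: pE1|exact: pE2].
  by apply/funext => -[x y]; rewrite /E1 /E2 /= c0 b0; congr pair; ring.
(* The standard factorisation of a matrix of determinant [D = 1] or [-1] whose
   lower left entry is nonzero into three shears. *)
pose D := a * d - b * c.
have D2 : D ^+ 2 = 1.
  rewrite /D (_ : _ ^+ 2 = (a ^+ 2 + b ^+ 2) * (c ^+ 2 + d ^+ 2) - (a * c + b *
    d) ^+ 2).
    by rewrite ab cd orth; ring.
  by ring.
rewrite (_ : (fun _ => _) = E2 1 ((a - D) / c) (e - (a - D) / c * f) \o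
    (E1 1 (c * D) f \o E2 D ((d - 1) * D / c) 0)).
  by do !apply: measure_preserving_comp; (exact: pE1 || exact: pE2).
apply/funext => -[x y]; rewrite /E1 /E2 /=.
have e2 : c * D * (D * x + (d - 1) * D / c * y) = c * x + (d - 1) * y.
  transitivity (D ^+ 2 * (c * x + (d - 1) * y)); last by rewrite D2 mul1r.
  by field.
have e1 : (d - 1) * D / c + (a - D) / c * d = b.
  by rewrite /D; field.
clearbody D; congr pair.
  transitivity (1 * (D * x + (d - 1) * D / c * y) +
      ((a - D) / c * (y + (c * D * (D * x + (d - 1) * D / c * y) + f)) +
       (e - (a - D) / c * f))); last by ring.
  by rewrite e2 -e1; field.
transitivity (y + (c * D * (D * x + (d - 1) * D / c * y) + f)); last by ring.
by rewrite e2; ring.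
Qed.

End MeasurePreserving.

(** * Measurability in the plane, and orthogonal matrices in coordinates *)

Section Coordinates.
Variable R : realType.
Local Notation mR := (measurableTypeR R).
Local Notation mu2 := ((@lebesgue_measure R) \x (@lebesgue_measure R))%E.

(** The product sigma-algebra is generated by rectangles, so [U] is exhibited as a countable union
    of squares with rational centers and radii [1 / (n + 1)]. *)
Lemma open_measurable_prod (U : set (R * R)) :
  open U -> measurable (U : set (mR * mR)).
Proof.
move=> oU.
pose box (q r : rat) n : set (mR * mR) :=
  ball (ratr q : R) n.+1%:R^-1 `*` ball (ratr r : R) n.+1%:R^-1.
pose piece q r n := if pselect (box q r n `<=` U) then box q r n else set0.
rewrite (_ : U = \bigcup_q \bigcup_r \bigcup_n piece q r n).
  apply: bigcupT_measurable_rat => q; apply: bigcupT_measurable_rat => r.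
  apply: bigcup_measurable => n _; rewrite /piece; case: pselect => bU /=;
    last exact: measurable0.
  by apply: measurableX; exact: measurable_ball.
apply/seteqP; split=> [p Up|p [q _ [r _ [n _]]]]; last first.
  by rewrite /piece; case: pselect => bU /=; [exact: bU|case].
have /nbhs_ballP[e /= e0 eU] : nbhs p U by exact: open_nbhs_nbhs.
have [n ne] : exists n, n.+1%:R^-1 < e / 2.
  have [|n] := @ltr_add_invr _ 0 (e / 2); first by rewrite divr_gt0.
  by rewrite add0r => ne; exists n.
have approx (x : R) : exists q : rat, `|ratr q - x| < n.+1%:R^-1.
  have [] := @rat_in_itvoo R (x - n.+1%:R^-1) (x + n.+1%:R^-1).
    by rewrite ltrD2l gtrN// invr_gt0.
  move=> q; rewrite in_itv/= => /andP[? ?]; exists q.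
  by rewrite ltr_distl; apply/andP.
have [q qp] := approx p.1; have [r rp] := approx p.2.
exists q => //; exists r => //; exists n => //; rewrite /piece;
  case: pselect => bU /=.
  by split; rewrite /box /= /ball/=.
case: bU => -[x y] [/= + +]; rewrite /ball/= => qx ry; apply: eU.
have close (s : rat) (t u : R) : `|ratr s - t| < n.+1%:R^-1 ->
    `|ratr s - u| < n.+1%:R^-1 -> `|t - u| < e.
  move=> st su; rewrite (_ : t - u = (t - ratr s) + (ratr s - u)); last by ring.
  apply: le_lt_trans (ler_normD _ _) _; rewrite [ltRHS]splitr (distrC t).
  by rewrite ltrD// (lt_trans _ ne).
by split; [exact: close qp qx|exact: close rp ry].
Qed.

Lemma point_of_continuous : continuous (@point_of R).
Proof.
move=> p U /nbhs_ballP[e /= e0 eU]; apply/nbhs_ballP; exists e => // q [q1 q2].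
by apply: eU; split=> // i j; rewrite !mxE; case: ifP.
Qed.

Lemma measurable_point_of (A : set 'rV[R]_2) :
  closed A -> measurable (@point_of R @^-1` A : set (mR * mR)).
Proof.
move=> /closed_openC oA.
have oP : open (@point_of R @^-1` (~` A)).
  by apply: open_comp => // p _; exact: point_of_continuous.
by have := measurableC (open_measurable_prod oP); rewrite preimage_setC setCK.
Qed.

Lemma ord2P (i : 'I_2) : i = 0 \/ i = 1.
Proof. by case: i => -[|[|]]// p; [left|right]; exact/val_inj. Qed.

Lemma row2P (u v : 'rV[R]_2) : u 0 0 = v 0 0 -> u 0 1 = v 0 1 -> u = v.
Proof.
move=> u0 u1; apply/rowP => i.
by have [->|->] := ord2P i.
Qed.

Lemma dotE (u v : 'rV[R]_2) : dot u v = u 0 0 * v 0 0 + u 0 1 * v 0 1.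
Proof.
rewrite /dot !big_ord_recl big_ord0 addr0; congr (_ + u 0 _ * v 0 _);
  exact/val_inj.
Qed.

Lemma mulmx2E (u : 'rV[R]_2) (Q : 'M[R]_2) i :
  (u *m Q) 0 i = u 0 0 * Q 0 i + u 0 1 * Q 1 i.
Proof.
rewrite mxE !big_ord_recl big_ord0 addr0; congr (_ + u 0 _ * Q _ i);
  exact/val_inj.
Qed.

Lemma orthogonal2P (Q : 'M[R]_2) : Q *m Q^T = 1%:M <->
  [/\ Q 0 0 ^+ 2 + Q 0 1 ^+ 2 = 1, Q 1 0 ^+ 2 + Q 1 1 ^+ 2 = 1 &
      Q 0 0 * Q 1 0 + Q 0 1 * Q 1 1 = 0].
Proof.
have E i j : (Q *m Q^T) i j = Q i 0 * Q j 0 + Q i 1 * Q j 1.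
  rewrite mxE !big_ord_recl big_ord0 addr0 !mxE.
  by congr (_ + Q i _ * Q j _); exact/val_inj.
split=> [Q1|[Q0 Q1 Q01]]; first by rewrite !expr2 -!E Q1 !mxE.
apply/matrixP => i j; rewrite E mxE.
by have [->|->] := ord2P i; have [->|->] := ord2P j; 
  rewrite -?expr2 /= ?mulr1n ?mulr0n// -[RHS]Q01; ring.
Qed.

Lemma dot_isometry (Q : 'M[R]_2) (u v : 'rV[R]_2) :
  Q *m Q^T = 1%:M -> dot (u *m Q) (v *m Q) = dot u v.
Proof.
move=> /orthogonal2P[Q0 Q1 Q01]; rewrite !dotE !mulmx2E.
transitivity (u 0 0 * v 0 0 * (Q 0 0 ^+ 2 + Q 0 1 ^+ 2) +
  u 0 1 * v 0 1 * (Q 1 0 ^+ 2 + Q 1 1 ^+ 2) +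
  (u 0 0 * v 0 1 + u 0 1 * v 0 0) *
    (Q 0 0 * Q 1 0 + Q 0 1 * Q 1 1)); first by ring.
by rewrite Q0 Q1 Q01; ring.
Qed.

End Coordinates.

(** * Area and mass center under isometries *)

Section Isometries.
Variable R : realType.
Local Notation mR := (measurableTypeR R).
Local Notation mu2 := ((@lebesgue_measure R) \x (@lebesgue_measure R))%E.
Implicit Types (A : set 'rV[R]_2) (Q : 'M[R]_2) (a : 'rV[R]_2).

(** [T] is the inverse isometry [x |-> (x - a) *m Q^T] read on pairs. It turns images, in which
    congruence is stated, into preimages, in which measures are transported. *)
Lemma isometry_pullback Q a : Q *m Q^T = 1%:M ->
  exists2 T : mR * mR -> mR * mR, measure_preserving T &
    (forall p, point_of (T p) *m Q + a = point_of p) /\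
    forall A, @point_of R @^-1` [set x *m Q + a | x in A] =
      T @^-1` (@point_of R @^-1` A).
Proof.
move=> Q1; have /orthogonal2P[Q00 Q11 Q01] := Q1.
pose T (p : mR * mR) : mR * mR :=
  (Q 0 0 * p.1 + Q 0 1 * p.2 - (Q 0 0 * a 0 0 + Q 0 1 * a 0 1),
   Q 1 0 * p.1 + Q 1 1 * p.2 - (Q 1 0 * a 0 0 + Q 1 1 * a 0 1)).
have QQ : Q^T *m Q = 1%:M by exact: mulmx1C.
have TE p : point_of (T p) = (point_of p - a) *m Q^T.
  by apply: row2P; rewrite mulmx2E !mxE /=; ring.
exists T; first exact: measure_preserving_isometry.
split=> [p|A]; first by rewrite TE -mulmxA QQ mulmx1 subrK.
apply/seteqP; split=> p /=.
  by case=> x Ax xp; rewrite TE -xp addrK -mulmxA Q1 mulmx1.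
by exists (point_of (T p)) => //; rewrite TE -mulmxA QQ mulmx1 subrK.
Qed.

Lemma area_isometry A Q a : closed A -> Q *m Q^T = 1%:M ->
  area [set x *m Q + a | x in A] = area A.
Proof.
move=> cA /(isometry_pullback a)[T [_ mT] [_ TA]].
by rewrite /area TA mT//; exact: measurable_point_of.
Qed.

Lemma compact_coord_bounded A : compact A ->
  exists2 M, 0 < M & forall x, A x -> forall b, `|x 0 b| <= M.
Proof.
move=> cA; have : forall b : 'I_2, exists2 M, 0 < M & forall x, A x ->
  `|x 0 b| <= M.
  move=> b.
  have /compact_bounded [M [_ AM]] : compact ((fun x : 'rV[R]_2 => x 0 b) @` A).
    apply: continuous_compact => //; apply: continuous_subspaceT.
    exact: coord_continuous.
  exists (`|M| + 1); first by rewrite ltr_wpDl.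
  move=> x Ax; apply: AM; last by exists x.
  by rewrite ltr_pwDr// ler_norm.
move=> /[dup] /(_ 0)[M0 M0_gt0 AM0] /(_ 1)[M1 M1_gt0 AM1].
exists (M0 + M1); first exact: addr_gt0.
move=> x Ax b; have [->|->] := ord2P b.
- by rewrite (le_trans (AM0 x Ax))// lerDl ltW.
- by rewrite (le_trans (AM1 x Ax))// lerDr ltW.
Qed.

(** Finiteness matters because [fine] in [area] would send an infinite measure to [0]. *)
Lemma compact_finite_measure A : compact A ->
  (mu2 (@point_of R @^-1` A) < +oo)%E.
Proof.
move=> cA; have [M M0 AM] := compact_coord_bounded cA.
pose J : set mR := `[- M, M]%classic.
have mJ : measurable J by exact: measurable_itv.
have IM : lebesgue_measure J = (M - - M)%:E.
  by rewrite lebesgue_measure_itv/= lte_fin gtrN.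
apply: (@le_lt_trans _ _ (mu2 (J `*` J))).
  apply: le_measure.
  - rewrite inE; apply: measurable_point_of; apply: compact_closed cA.
    exact: norm_hausdorff.
  - by rewrite inE; exact: measurableX.
  - move=> p /AM pM; have := pM 0; have := pM 1.
    by rewrite !mxE /= !ler_norml; split; rewrite /J /= in_itv.
rewrite [ltLHS](_ : _ = (M - - M)%:E * (M - - M)%:E)%E;
  first by rewrite -EFinM ltry.
rewrite -IM; exact: product_measure1E.
Qed.

Lemma area_gt0 A : compact A -> A° !=set0 -> 0 < area A.
Proof.
move=> cA [x Ax].
have /nbhs_ballP[e /= e0 eA] : nbhs x A by [].
rewrite /area fine_gt0// compact_finite_measure// andbT.
apply: (@lt_le_trans _ _ (mu2 (ball (x 0 0) e `*` ball (x 0 1) e))).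
  rewrite [ltRHS](_ : _ = (e *+ 2)%:E * (e *+ 2)%:E)%E.
    by rewrite -EFinM lte_fin mulr_gt0// mulrn_wgt0.
  rewrite -{1}(lebesgue_measure_ball (x 0 0) (ltW e0)).
  rewrite -(lebesgue_measure_ball (x 0 1) (ltW e0)).
  by apply: product_measure1E; exact: measurable_ball.
apply: le_measure.
- by rewrite inE; apply: measurableX; exact: measurable_ball.
- rewrite inE; apply: measurable_point_of; apply: compact_closed cA.
  exact: norm_hausdorff.
- move=> p [p0 p1]; apply: eA; split=> // i j; rewrite ord1 mxE.
  by have [->|->] := ord2P j.
Qed.

Lemma integrable_affine A (u v w : R) : compact A ->
  mu2.-integrable (@point_of R @^-1` A)
    (EFin \o (fun p : mR * mR => u * p.1 + v * p.2 + w)).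
Proof.
move=> cA; have [M M0 AM] := compact_coord_bounded cA.
apply: measurable_bounded_integrable.
- apply: measurable_point_of; apply: compact_closed cA; exact: norm_hausdorff.
- exact: compact_finite_measure.
- apply: measurable_funD => //; apply: measurable_funD;
    apply: measurable_funM => //;
    exact: measurable_funTS.
- exists (`|u| * M + `|v| * M + `|w|); split; first exact: num_real.
  move=> z lez p /AM pM; apply: le_trans (ltW lez).
  have := pM 0; have := pM 1; rewrite !mxE /= => p1 p0.
  apply: le_trans (ler_normD _ _) _; rewrite lerD2r.
  by apply: le_trans (ler_normD _ _) _; rewrite !normrM lerD// ler_wpM2l.
Qed.

Lemma continuous_row2 (T : topologicalType) (f : T -> 'rV[R]_2) :
  (forall b, continuous (fun x => f x 0 b)) -> continuous f.
Proof.
move=> cf x U /nbhs_ballP[e /= e0 eU].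
have near_f b : nbhs x ((fun y => f y 0 b) @^-1` ball (f x 0 b) e).
  by apply: cf; exact: nbhsx_ballx.
apply: filterS (filterI (near_f 0) (near_f 1)) => y [y0 y1].
apply: eU; split=> // i j; rewrite ord1.
by have [->|->] := ord2P j; [exact: y0|exact: y1].
Qed.

Lemma continuous_lincomb (T : topologicalType) n (f : 'I_n -> T -> R)
    (c : 'I_n -> R) (d : R) :
  (forall i, continuous (f i)) -> continuous (fun x => \sum_i f i x * c i + d).
Proof.
move=> cf x; apply: cvgD; last exact: cvg_cst.
apply: cvg_big => [|i _]; first by move=> z; exact: add_continuous.
by apply: cvgM; [exact: cf|exact: cvg_cst].
Qed.

Lemma continuous_mulmx_row2 n (V : 'M[R]_(n, 2)) (a : 'rV[R]_2) :
  continuous (fun w : 'rV[R]_n => w *m V + a).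
Proof.
apply: continuous_row2 => b.
rewrite (_ : (fun _ => _) = (fun w : 'rV[R]_n => \sum_i w 0 i * V i b + a 0 b)).
  by apply: continuous_lincomb => i; exact: coord_continuous.
by apply/funext => w; rewrite !mxE.
Qed.

Lemma compact_isometry A Q a : compact A -> compact [set x *m Q + a | x in A].
Proof.
move=> cA; apply: continuous_compact => //; apply: continuous_subspaceT.
exact: continuous_mulmx_row2.
Qed.

(** A change of variables along [T] brings the integral back to [A], where the coordinate has become
    an affine function. The nonzero area lets the translation [a] come out of the average
    unchanged. *)
Lemma mass_center_isometry A Q a : compact A -> area A != 0 ->
  Q *m Q^T = 1%:M ->
  mass_center [set x *m Q + a | x in A] = mass_center A *m Q + a.
Proof.
move=> cA A0 Q1.
have clA : closed A by apply: compact_closed cA; exact: norm_hausdorff.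
have [T [mT muT] [TE TA]] := isometry_pullback a Q1.
have mA := measurable_point_of clA.
have TEb b p : Q 0 b * (T p).1 + Q 1 b * (T p).2 + a 0 b = point_of p 0 b.
  by rewrite -TE mxE mulmx2E !mxE /=; congr (_ + _ + _); rewrite mulrC.
have I b : Rintegral mu2 (@point_of R @^-1` [set x *m Q + a | x in A])
    (fun p => point_of p 0 b) =
  Rintegral mu2 (@point_of R @^-1` A)
    (fun p => Q 0 b * p.1 + Q 1 b * p.2 + a 0 b).
  transitivity (fine (\int[pushforward mu2 T]_(p in @point_of R @^-1` A)
      ((Q 0 b * p.1 + Q 1 b * p.2 + a 0 b)%:E))%E).
    rewrite /Rintegral integral_pushforward//.
    - by rewrite TA; congr fine; apply: eq_integral => p _; rewrite /= TEb.
    - apply/measurable_EFinP; apply: measurable_funD => //.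
      by apply: measurable_funD; apply: measurable_funM.
    - rewrite -TA.
      (* The coordinate [b] is written as an affine function with coefficients [0] and [1]. *)
      have := integrable_affine (b == 0)%:R (b != 0)%:R 0
        (compact_isometry (Q := Q) (a := a) cA).
      congr (_.-integrable _ _); apply/funext => p /=; rewrite TEb mxE.
      by case: ifP => _ /=; rewrite mul0r mul1r ?addr0 ?add0r.
  by apply: (congr1 fine); apply: eq_measure_integral => B mB _; exact: muT.
have J u v w : Rintegral mu2 (@point_of R @^-1` A)
    (fun p => u * p.1 + v * p.2 + w) =
  u * Rintegral mu2 (@point_of R @^-1` A) (fun p => p.1) +
  v * Rintegral mu2 (@point_of R @^-1` A) (fun p => p.2) + w * area A.
  have int f x y t : (forall p, f p = x * p.1 + y * p.2 + t) ->
      mu2.-integrable (@point_of R @^-1` A) (EFin \o (f : mR * mR -> R)).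
    move=> fE; have := integrable_affine x y t cA.
    by congr (_.-integrable _ _); apply/funext => p /=; rewrite fE.
  have i1 x : mu2.-integrable (@point_of R @^-1` A)
      (EFin \o (fun p : mR * mR => x * p.1)).
    by apply: (int _ x 0 0) => p; ring.
  have i2 x : mu2.-integrable (@point_of R @^-1` A)
      (EFin \o (fun p : mR * mR => x * p.2)).
    by apply: (int _ 0 x 0) => p; ring.
  rewrite RintegralD//; last 2 first.
  - by apply: (int _ u v 0) => p; ring.
  - by apply: (int _ 0 0 w) => p; ring.
  rewrite RintegralD// Rintegral_cst//; congr (_ + _ + _).
    by apply: RintegralZl => //; apply: (int _ 1 0 0) => p; ring.
  by apply: RintegralZl => //; apply: (int _ 0 1 0) => p; ring.
have E b : mass_center [set x *m Q + a | x in A] 0 b =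
  (mass_center A *m Q + a) 0 b.
  rewrite mxE I J area_isometry// mxE mulmx2E !mxE.
  set u := Rintegral _ _ _; set v := Rintegral _ _ _.
  rewrite (_ : Rintegral _ _ _ = u); last by congr Rintegral; apply/funext => p;
    rewrite mxE.
  rewrite (_ : Rintegral _ _ _ = v); last by congr Rintegral; apply/funext => p;
    rewrite mxE.
  by field.
by apply: row2P.
Qed.

End Isometries.

(** * Convex and regular polygons *)

Section Regions.
Variable R : realType.
Implicit Types (u v x y n : 'rV[R]_2) (p : polygon R).

(** The counterclockwise rotation by a right angle. On an edge of a counterclockwise polygon it
    gives the inner normal, scaled by the length. *)
Definition rot u : 'rV[R]_2 := \row_b (if b == 0 then - u 0 1 else u 0 0).

Lemma dot_rot u v : dot (rot u) v = cross u v.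
Proof. by rewrite dotE !mxE /cross /=; ring. Qed.

Lemma dotDr u v x : dot u (v + x) = dot u v + dot u x.
Proof. by rewrite !dotE !mxE; ring. Qed.

Lemma dotBr u v x : dot u (v - x) = dot u v - dot u x.
Proof. by rewrite !dotE !mxE; ring. Qed.

Lemma dotZr u v (t : R) : dot u (t *: v) = t * dot u v.
Proof. by rewrite !dotE !mxE; ring. Qed.

Lemma dotDl u v x : dot (u + v) x = dot u x + dot v x.
Proof. by rewrite !dotE !mxE; ring. Qed.

Lemma dotZl u v (t : R) : dot (t *: u) v = t * dot u v.
Proof. by rewrite !dotE !mxE; ring. Qed.

Lemma dot_sumr (I : finType) u (F : I -> 'rV[R]_2) :
  dot u (\sum_i F i) = \sum_i dot u (F i).
Proof.
apply: (big_morph (dot u)) => [x y|]; first exact: dotDr.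
by rewrite dotE !mxE; ring.
Qed.

Lemma dot_ge0 u : 0 <= dot u u.
Proof. by rewrite dotE -!expr2 addr_ge0 ?sqr_ge0. Qed.

Lemma dot_eq0 u : (dot u u == 0) = (u == 0).
Proof.
apply/idP/eqP => [|->]; last by rewrite dotE !mxE mul0r addr0.
rewrite dotE -!expr2 paddr_eq0 ?sqr_ge0// !sqrf_eq0 => /andP[/eqP u0 /eqP u1].
by apply: row2P; rewrite mxE.
Qed.

Lemma dot_gt0 u : (0 < dot u u) = (u != 0).
Proof. by rewrite lt_def dot_ge0 andbT dot_eq0. Qed.

Lemma dot_continuous u : continuous (fun x => dot u x).
Proof.
rewrite (_ : (fun _ => _) = (fun x : 'rV[R]_2 => \sum_(i < 2) x 0 i * u 0 i +
  0)).
  by apply: continuous_lincomb => i; exact: coord_continuous.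
by apply/funext => x; rewrite addr0; apply: eq_bigr => i _; rewrite mulrC.
Qed.

(** The region is the image of the standard simplex under [w |-> w *m V]. The simplex is cut out of
    a cube, since nonnegative weights with sum [1] are at most [1]. *)
Lemma region_compact p : compact (region p).
Proof.
pose V := \matrix_(k, b) @vertex R p k 0 b.
pose K : set 'rV[R]_(nb_sides p) :=
  [set w | forall k, `[0, 1]%classic (w ord0 k)] `&` [set w | \sum_k w 0 k = 1].
rewrite (_ : region p = (fun w => w *m V + 0) @` K).
  apply: continuous_compact.
    by apply: continuous_subspaceT; exact: continuous_mulmx_row2.
  apply: compact_closedI.
    by apply: (@rV_compact R _ (fun=> `[0, 1]%classic)) => _;
      exact: segment_compact.
  have cl : closed ((fun w : 'rV[R]_(nb_sides p) => \sum_k w 0 k * 1 + 0) @^-1`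
    [set 1]).
    apply: preimage_closed; last exact: closed_eq.
    by move=> w _; apply: continuous_lincomb => i; exact: coord_continuous.
  have E (w : 'rV[R]_(nb_sides p)) : \sum_k w 0 k * 1 + 0 = \sum_k w 0 k.
    by rewrite addr0; apply: eq_bigr => k _; rewrite mulr1.
  by congr (closed _): cl; apply/seteqP; split=> w /=; rewrite E.
have E (w : 'rV_(nb_sides p)) : w *m V + 0 = \sum_k w 0 k *: vertex k.
  by apply/rowP => b; rewrite addr0 mxE summxE; apply: eq_bigr => k _;
    rewrite !mxE.
apply/seteqP; split=> [x [w [w0 w1 ->]]|_ [w [w01 w1] <-]]; last first.
  exists (fun k => w 0 k); split=> // k.
  by have := w01 k; rewrite /= in_itv/= => /andP[].
exists (\row_k w k); last first.
  by rewrite E; apply: eq_bigr => k _; rewrite mxE.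
split=> [k|]; last by rewrite /= -[RHS]w1; apply: eq_bigr => k _; rewrite mxE.
rewrite /= mxE in_itv/= w0 -w1 (bigD1 k)//= lerDl.
by apply: sumr_ge0.
Qed.

Lemma region_closed p : closed (region p).
Proof. by apply: compact_closed (@region_compact p); exact: norm_hausdorff. Qed.

Lemma vertex_region p (k : 'I_(nb_sides p)) : region p (vertex k).
Proof.
exists (fun j => (j == k)%:R); split.
- by move=> j; exact: ler0n.
- by rewrite (bigD1 k)//= eqxx big1 ?addr0// => j /negbTE ->.
- by rewrite (bigD1 k)//= eqxx scale1r big1 ?addr0// => j /negbTE ->;
    rewrite scale0r.
Qed.

(** Three points are taken at once to suit barycentric coordinates in a triangle. *)
Lemma region_convex3 p x y z (s t r : R) :
  region p x -> region p y -> region p z ->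
  0 <= s -> 0 <= t -> 0 <= r -> s + t + r = 1 ->
  region p (s *: x + t *: y + r *: z).
Proof.
move=> [w [w0 w1 ->]] [w' [w0' w1' ->]] [w'' [w0'' w1'' ->]] s0 t0 r0 str.
exists (fun k => s * w k + t * w' k + r * w'' k); split.
- by move=> k; rewrite !addr_ge0// mulr_ge0.
- by rewrite !big_split/= -!mulr_sumr w1 w1' w1'' !mulr1.
- rewrite !scaler_sumr -!big_split/=; apply: eq_bigr => k _.
  by rewrite !scalerDl !scalerA.
Qed.

Lemma segment_region p x y : region p x -> region p y ->
  segment x y `<=` region p.
Proof.
move=> px py _ [t /andP[t0 t1] ->].
rewrite (_ : _ + _ = (1 - t) *: x + t *: y + 0 *: y).
  by apply: region_convex3 => //; lra.
by apply: row2P; rewrite !mxE; ring.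
Qed.

Lemma region_ge p n (c : R) :
  (forall k : 'I_(nb_sides p), c <= dot n (vertex k)) ->
  forall x, region p x -> c <= dot n x.
Proof.
move=> nc x [w [w0 w1 ->]]; rewrite dot_sumr -[leLHS]mul1r -w1 mulr_suml.
by apply: ler_sum => k _; rewrite dotZr ler_wpM2l.
Qed.

Lemma region_gt p n (c : R) :
  (forall k : 'I_(nb_sides p), c < dot n (vertex k)) ->
  forall x, region p x -> c < dot n x.
Proof.
move=> nc x [w [w0 w1 ->]]; rewrite dot_sumr -[ltLHS]mul1r -w1 mulr_suml.
have [k wk] : exists k, 0 < w k.
  apply: contrapT => nw; have: \sum_k w k = 0.
    rewrite big1// => k _; apply/eqP; rewrite eq_le w0 andbT leNgt.
    by apply/negP => wk; apply: nw; exists k.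
  by rewrite w1; apply/eqP; rewrite oner_neq0.
rewrite (bigD1 k)//= [ltRHS](bigD1 k)//=; apply: ltr_leD.
  by rewrite dotZr ltr_pM2l.
by apply: ler_sum => j _; rewrite dotZr ler_wpM2l// ltW.
Qed.

(** Divided by their sum [D], the three cross products are the barycentric coordinates of the point;
    asking them to be positive defines an open set. *)
Lemma triangle_interior p a b c x :
  region p a -> region p b -> region p c ->
  0 < cross (b - a) (x - a) -> 0 < cross (c - b) (x - b) ->
  0 < cross (a - c) (x - c) -> (region p)° x.
Proof.
move=> pa pb pc xa xb xc.
pose U y := [/\ 0 < cross (b - a) (y - a), 0 < cross (c - b) (y - b) &
  0 < cross (a - c) (y - c)].
have half u v : open [set y | 0 < cross u (y - v)].
  rewrite (_ : [set _ | _] = dot (rot u) @^-1` [set s | dot (rot u) v < s]).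
    by apply: open_comp => // y _; exact: dot_continuous.
  by apply/seteqP; split=> y /=; rewrite -dot_rot dotBr subr_gt0.
have oU : open U.
  rewrite (_ : U = [set y | 0 < cross (b - a) (y - a)] `&`
    ([set y | 0 < cross (c - b) (y - b)] `&`
     [set y | 0 < cross (a - c) (y - c)])).
    by apply: openI => //; exact: openI.
  by apply/seteqP; split=> y [] // ? [].
have UA : U `<=` region p.
  move=> y [ya yb yc].
  pose D := cross (b - a) (y - a) + cross (c - b) (y - b) +
    cross (a - c) (y - c).
  have D0 : 0 < D by exact: (addr_gt0 (addr_gt0 ya yb) yc).
  rewrite (_ : y = (cross (c - b) (y - b) / D) *: a +
      (cross (a - c) (y - c) / D) *: b + (cross (b - a) (y - a) / D) *: c).
    apply: region_convex3 => //; rewrite ?divr_ge0 ?ltW//.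
    by rewrite -!mulrDl addrC addrA divff// gt_eqF.
  have Dn : D != 0 by rewrite gt_eqF.
  apply: (scalerI Dn); rewrite !scalerDr !scalerA !(mulrC D) !divfK//.
  by apply: row2P; rewrite /D /cross !mxE; ring.
by move: UA; rewrite open_subsetE// => /(_ x); apply.
Qed.

End Regions.

(** * Vertices and sides characterised by the convex region *)

Section ConvexPolygons.
Variable R : realType.
Implicit Types (u v x y n : 'rV[R]_2).

(** Congruence speaks of regions and not of vertex lists. Exposed points recover the vertices from
    the region alone, and [supported] pairs recover the sides. *)
Definition exposed (A : set 'rV[R]_2) x : Prop :=
  A x /\ exists n, forall y, A y -> y != x -> dot n x < dot n y.

Definition supported (A : set 'rV[R]_2) x y : Prop :=
  exists2 n, n != 0 & dot n x = dot n y /\ forall z, A z -> dot n x <= dot n z.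

Lemma exposed_isometry A (Q : 'M[R]_2) a x : Q *m Q^T = 1%:M ->
  exposed A x -> exposed [set y *m Q + a | y in A] (x *m Q + a).
Proof.
move=> Q1 [Ax [n nA]]; split; first by exists x.
exists (n *m Q) => _ [y Ay <-] yx.
rewrite !dotDr ltrD2r !dot_isometry//; apply: nA => //.
by apply: contra_neq yx => ->.
Qed.

Lemma supported_isometry A (Q : 'M[R]_2) a x y : Q *m Q^T = 1%:M ->
  supported A x y -> supported [set y *m Q + a | y in A] (x *m Q + a)
    (y *m Q + a).
Proof.
move=> Q1 [n n0 [nxy nA]]; exists (n *m Q).
  by apply: contra_neq n0 => nQ0; rewrite -[n]mulmx1 -Q1 mulmxA nQ0 mul0mx.
split; first by rewrite !dotDr !dot_isometry// nxy.
by move=> _ [z Az <-]; rewrite !dotDr lerD2r !dot_isometry// nA.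
Qed.

Section Convex.
Variable p : polygon R.
Hypothesis conv : convex_polygon p.
Implicit Types k j : 'I_(nb_sides p).

Lemma ordS_neq k : ordS k != k.
Proof.
have [n3 _] := conv; apply/eqP => /(congr1 val) /=.
have kn := ltn_ord k; have [kn'|] := ltnP k.+1 (nb_sides p).
  by rewrite modn_small//; lia.
by move=> nk; rewrite (_ : k.+1 = nb_sides p) ?modnn; lia.
Qed.

Lemma ordSS_neq k : ordS (ordS k) != k.
Proof.
have [n3 _] := conv; apply/eqP => /(congr1 val) /=.
have kn := ltn_ord k; have [kn'|nk] := ltnP k.+1 (nb_sides p).
  rewrite (modn_small kn'); have [kn''|nk] := ltnP k.+2 (nb_sides p).
    by rewrite modn_small//; lia.
  by rewrite (_ : k.+2 = nb_sides p) ?modnn; lia.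
by rewrite (_ : k.+1 = nb_sides p) ?modnn ?modn_small; lia.
Qed.

Lemma cross_edge_ge0 k j : 0 <= cross (edge k) (vertex j - vertex k).
Proof.
have [jk|jk] := eqVneq j k; first by rewrite jk /cross subrr !mxE !mulr0 subrr.
have [->|jSk] := eqVneq j (ordS k); first by rewrite /cross mulrC subrr.
by rewrite ltW// conv.2.
Qed.

Lemma edge_neq0 k : edge k != 0.
Proof.
apply/eqP => e0.
have := conv.2 k (ordS (ordS k)) (ordSS_neq _) (ordS_neq _).
by rewrite e0 /cross !mxE !mul0r subrr ltxx.
Qed.

Lemma vertex_inj : injective (@vertex R p).
Proof.
move=> k j kj; apply: contrapT => /eqP; rewrite eq_sym => jk.
have [jSk|jSk] := eqVneq j (ordS k).
  by have := edge_neq0 k; rewrite /edge kj jSk subrr eqxx.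
by have := conv.2 k j jk jSk; rewrite kj subrr /cross !mxE !mulr0 subrr ltxx.
Qed.

Lemma region_left k x : region p x -> 0 <= cross (edge k) (x - vertex k).
Proof.
rewrite -dot_rot dotBr subr_ge0; apply: region_ge => j.
by rewrite -subr_ge0 -dotBr dot_rot cross_edge_ge0.
Qed.

Lemma cross_pred_gt0 k j : j != k -> j != ord_pred k ->
  0 < cross (edge (ord_pred k)) (vertex j - vertex k).
Proof.
move=> jk jPk; have := conv.2 (ord_pred k) j jPk.
by rewrite ord_predK => /(_ jk); rewrite /edge ord_predK /cross !mxE; lra.
Qed.

(* The sum of the inner normals of the two sides at [vertex k] exposes it. *)
Lemma vertex_exposed k : exposed (region p) (vertex k).
Proof.
split; first exact: vertex_region.
pose n := rot (edge k) + rot (edge (ord_pred k)).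
exists n => y [w [w0 w1 ye]] yk.
have pos j : j != k -> 0 < dot n (vertex j - vertex k).
  move=> jk; rewrite dotDl !dot_rot.
  have [jPk|jPk] := eqVneq j (ord_pred k).
    apply: ltr_wpDr.
      have := cross_edge_ge0 (ord_pred k) j.
      by rewrite /edge ord_predK /cross !mxE; lra.
    apply: conv.2 => //; rewrite jPk; apply/eqP => /(congr1 (@ordS _)).
    by rewrite ord_predK => /eqP; rewrite eq_sym (negbTE (ordSS_neq k)).
  by apply: ltr_wpDl; [exact: cross_edge_ge0|exact: cross_pred_gt0].
rewrite -subr_gt0 -dotBr.
have -> : y - vertex k = \sum_j w j *: (vertex j - vertex k).
  rewrite ye -[vertex k in LHS]scale1r -w1 scaler_suml -sumrB.
  by apply: eq_bigr => j _; rewrite scalerBr.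
rewrite dot_sumr lt_def; apply/andP; split; last first.
  apply: sumr_ge0 => j _; rewrite dotZr mulr_ge0//.
  by have [->|/pos/ltW//] := eqVneq j k; rewrite subrr dotE !mxE !mulr0 addr0.
apply: contra_neq yk => /eqP; rewrite psumr_eq0; last first.
  move=> j _; rewrite dotZr mulr_ge0//.
  by have [->|/pos/ltW//] := eqVneq j k; rewrite subrr dotE !mxE !mulr0 addr0.
move=> /allP s0.
have wj j : j != k -> w j = 0.
  move=> jk; have := s0 j (mem_index_enum _); rewrite /= dotZr mulf_eq0.
  by rewrite (gt_eqF (pos j jk)) orbF => /eqP.
rewrite ye (bigD1 k)//= big1 ?addr0; last by move=> j /wj ->; rewrite scale0r.
by rewrite -[RHS]scale1r -w1 (bigD1 k)//= [X in (_ + X)]big1 ?addr0.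
Qed.

(** If [x] were no vertex, the exposing functional would be larger than [dot n x] at all vertices,
    hence on the whole region, including [x] itself. *)
Lemma exposed_vertex x : exposed (region p) x -> exists k, x = vertex k.
Proof.
move=> [px [n nA]]; apply: contrapT => nk.
suff : dot n x < dot n x by rewrite ltxx.
apply: region_gt px => k; apply: nA; first exact: vertex_region.
by apply/eqP => kx; apply: nk; exists k.
Qed.

Lemma side_supported k : supported (region p) (vertex k) (vertex (ordS k)).
Proof.
exists (rot (edge k)).
  apply: contra_neq (edge_neq0 k) => r0; apply: row2P.
    by have := congr1 (fun u : 'rV[R]_2 => u 0 1) r0; rewrite !mxE.
  by have := congr1 (fun u : 'rV[R]_2 => - u 0 0) r0;
    rewrite !mxE /= opprK oppr0.
split; first by rewrite /rot /edge !dotE !mxE /=; ring.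
by move=> z /(region_left k); rewrite -dot_rot dotBr subr_ge0.
Qed.

(** If [k] and [j] were not consecutive, the two neighbors of [k] would lie strictly on opposite
    sides of the diagonal [u], so the line through [u] could not support the region. *)
Lemma supported_side k j : supported (region p) (vertex k) (vertex j) ->
  j != k -> j = ordS k \/ k = ordS j.
Proof.
move=> [n n0 [nkj nA]] jk.
have [->|jSk] := eqVneq j (ordS k); first by left.
have [->|jPk] := eqVneq j (ord_pred k); first by right; rewrite ord_predK.
exfalso; set u := vertex j - vertex k.
have nu : dot n u = 0 by rewrite dotBr nkj subrr.
have S0 : 0 <= dot n (vertex (ordS k) - vertex k).
  by rewrite dotBr subr_ge0 nA//; exact: vertex_region.
have P0 : 0 <= dot n (vertex (ord_pred k) - vertex k).
  by rewrite dotBr subr_ge0 nA//; exact: vertex_region.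
have cS : cross u (vertex (ordS k) - vertex k) < 0.
  by have := conv.2 k j jk jSk; rewrite -/u /edge /cross; lra.
have cP : 0 < cross u (vertex (ord_pred k) - vertex k).
  have := cross_pred_gt0 jk jPk; rewrite -/u /edge ord_predK /cross !mxE; lra.
(* As [n] is orthogonal to [u], the sign of [dot n v] is that of [cross u v] up to the fixed factor
   [cross u n], which must therefore vanish. *)
have key v : dot n v * dot u u = cross u n * cross u v.
  transitivity (dot n u * dot u v + cross u n * cross u v).
    by rewrite !dotE /cross; ring.
  by rewrite nu mul0r add0r.
have c0 : cross u n = 0.
  apply/eqP; rewrite eq_le; apply/andP; split.
    by rewrite -(nmulr_lge0 _ cS) -key mulr_ge0// dot_ge0.
  by rewrite -(pmulr_lge0 _ cP) -key mulr_ge0// dot_ge0.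
have := key n; rewrite c0 mul0r => /eqP;
  rewrite mulf_eq0 !dot_eq0 (negbTE n0) /=.
by move=> /eqP u0; move: cP; rewrite u0 /cross !mxE !mul0r subrr ltxx.
Qed.

Lemma region_interior : (region p)° !=set0.
Proof.
have [n3 _] := conv.
pose k : 'I_(nb_sides p) := Ordinal (ltn_trans (ltn0Sn 1) n3).
pose a := vertex k; pose b := vertex (ordS k); pose c := vertex (ordS (ordS k)).
have abc := conv.2 k (ordS (ordS k)) (ordSS_neq _) (ordS_neq _).
exists (3^-1 *: (a + b + c)).
have := abc; rewrite /edge -/a -/b -/c /cross !mxE => {}abc.
apply: (@triangle_interior _ _ a b c); try exact: vertex_region;
  rewrite /cross !mxE; lra.
Qed.

End Convex.
End ConvexPolygons.

(** * The mass center of a regular polygon *)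

Section RegularPolygons.
Variable R : realType.
Implicit Types (u v x y n : 'rV[R]_2).

Definition midpoint (p : polygon R) (k : 'I_(nb_sides p)) : 'rV[R]_2 :=
  2^-1 *: (vertex k + vertex (ordS k)).

Lemma ordS_invariant (n : nat) (T : Type) (f : 'I_n -> T) :
  (forall k, f (ordS k) = f k) -> forall k j, f k = f j.
Proof.
case: n f => [|n] f fS; first by case.
have it m : f (iter m (@ordS n.+1) ord0) = f ord0.
  by elim: m => //= m IH; rewrite fS.
have itE (k : 'I_n.+1) : k = iter k (@ordS n.+1) ord0.
  suff E m : (val (iter m (@ordS n.+1) ord0) = m %% n.+1)%N.
    by apply: val_inj; rewrite E modn_small.
  by elim: m => [|m IH] /=; rewrite ?mod0n// IH -addn1 modnDml addn1.
by move=> k j; rewrite (itE k) (itE j) !it.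
Qed.

Lemma lagrange u v : dot u v ^+ 2 + cross u v ^+ 2 = dot u u * dot v v.
Proof. by rewrite !dotE /cross; ring. Qed.

Lemma enorm_sqr u : enorm u ^+ 2 = dot u u.
Proof. by rewrite sqr_sqrtr// dot_ge0. Qed.

Lemma enorm_gt0 u : (0 < enorm u) = (u != 0).
Proof. by rewrite sqrtr_gt0 dot_gt0. Qed.

(** The quotient lies in [[-1, 1]], where [acos] inverts [cos], by the Cauchy-Schwarz inequality
    contained in [lagrange]. *)
Lemma cos_angle u v : u != 0 -> v != 0 ->
  cos (angle u v) = dot u v / (enorm u * enorm v).
Proof.
move=> u0 v0; rewrite acosK// in_itv/= -ler_norml normf_div.
have uv0 : 0 < enorm u * enorm v by rewrite mulr_gt0// enorm_gt0.
rewrite (gtr0_norm uv0) ler_pdivrMr// mul1r -ler_sqr ?nnegrE ?(ltW uv0)//.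
by rewrite exprMn !enorm_sqr -lagrange real_normK ?num_real// lerDl sqr_ge0.
Qed.

Section Regular.
Variable p : polygon R.
Hypothesis reg : regular_polygon p.
Implicit Types k j : 'I_(nb_sides p).

Let conv : convex_polygon p. Proof. by case: reg. Qed.

Lemma regular_enorm k j : enorm (edge k) = enorm (edge j).
Proof. by case: reg. Qed.

Lemma regular_edge k j : dot (edge k) (edge k) = dot (edge j) (edge j).
Proof. by rewrite -!enorm_sqr (regular_enorm k j). Qed.

Lemma cross_edge_gt0 k : 0 < cross (edge k) (edge (ordS k)).
Proof.
have := conv.2 k _ (ordSS_neq conv _) (ordS_neq conv _).
by rewrite /edge /cross !mxE; lra.
Qed.

(** The interior angle at [ordS k] is formed by [edge (ordS k)] and [- edge k]; with equal side
    lengths its cosine determines the product. *)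
Lemma regular_dot k j :
  dot (edge k) (edge (ordS k)) = dot (edge j) (edge (ordS j)).
Proof.
have [_ _ ang] := reg.
have E (i : 'I_(nb_sides p)) : cos (interior_angle (ordS i)) =
    - (dot (edge i) (edge (ordS i)) / dot (edge k) (edge k)).
  have pe : vertex (ord_pred (ordS i)) - vertex (ordS i) = - edge i.
    by rewrite ordSK /edge opprB.
  rewrite /interior_angle pe -/(edge (ordS i)) cos_angle ?oppr_eq0 ?edge_neq0//.
  have -> : enorm (- edge i) = enorm (edge i).
    by rewrite /enorm; congr Num.sqrt; rewrite !dotE !mxE; ring.
  rewrite (regular_enorm i k) (regular_enorm (ordS i) k) -expr2 enorm_sqr
    -mulNr.
  by congr (_ / _); rewrite !dotE !mxE; ring.
have := E k; rewrite (ang _ (ordS j)) E => /oppr_inj/esym; apply/mulIf.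
by rewrite invr_eq0 dot_eq0 edge_neq0.
Qed.

(** The squares agree by [lagrange], and convexity makes both cross products positive. *)
Lemma regular_cross k j :
  cross (edge k) (edge (ordS k)) = cross (edge j) (edge (ordS j)).
Proof.
apply/eqP; rewrite -(@eqrXn2 _ 2) ?ltW ?cross_edge_gt0//; apply/eqP.
have := lagrange (edge k) (edge (ordS k));
  have := lagrange (edge j) (edge (ordS j)).
rewrite (regular_dot k j) (regular_edge k j) (regular_edge (ordS k) j).
by rewrite (regular_edge (ordS j) j); lra.
Qed.

(** [c] and [s] are the cosine and the sine of the exterior angle. *)
Lemma regular_rotation : exists (c s : R), [/\ c ^+ 2 + s ^+ 2 = 1, 0 < s &
  forall k, edge (ordS k) = c *: edge k + s *: rot (edge k)].
Proof.
have [n3 _] := conv.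
pose k0 : 'I_(nb_sides p) := Ordinal (ltn_trans (ltn0Sn 1) n3).
pose L := dot (edge k0) (edge k0).
have L0 : 0 < L by rewrite dot_gt0 edge_neq0.
have LN : L != 0 by rewrite gt_eqF.
exists (dot (edge k0) (edge (ordS k0)) / L),
  (cross (edge k0) (edge (ordS k0)) / L).
split; last first.
- move=> k; apply: (scalerI LN);
    rewrite [RHS]scalerDr !scalerA !(mulrC L) !divfK//.
  rewrite (regular_dot k0 k) (regular_cross k0 k) /L (regular_edge k0 k).
  by apply: row2P; rewrite !dotE /cross !mxE /=; ring.
- by rewrite divr_gt0 ?cross_edge_gt0.
- rewrite !expr_div_n -mulrDl lagrange (regular_edge (ordS k0) k0) -/L expr2.
  by rewrite divff// mulf_neq0.
Qed.

Lemma regular_center : exists2 kappa : R, 0 < kappa & forall k,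
  mass_center (region p) = midpoint k + kappa *: rot (edge k).
Proof.
have [c [s [cs s0 eS]]] := regular_rotation.
have c1 : 0 < 1 - c.
  have s2 : 0 < s ^+ 2 by rewrite exprn_gt0.
  by nra.
(* Half the cotangent of half the exterior angle, that is, the ratio of the apothem to the side
   length. *)
pose kappa := s / (2 * (1 - c)).
have kappaE : 2 * (1 - c) * kappa = s by rewrite /kappa; field; rewrite gt_eqF.
have kappa0 : 0 < kappa by rewrite divr_gt0// mulr_gt0.
clearbody kappa; exists kappa => //.
(* The candidate center seen from side [k]; the next steps show that it is the same for all
   sides. *)
pose o k := 2^-1 *: (vertex k + vertex (ordS k)) + kappa *: rot (edge k).
have sk : s * kappa = 2^-1 * (1 + c).
  apply: (@mulfI _ (2 * (1 - c))); first by rewrite gt_eqF// mulr_gt0.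
  rewrite mulrCA kappaE (_ : s * s = 1 - c ^+ 2); last by rewrite -cs; ring.
  by field.
have kc : kappa * (1 - c) = 2^-1 * s by lra.
have v1 k : vertex (ordS k) = vertex k + edge k by rewrite /edge addrC subrK.
have oS k : o (ordS k) = o k.
  have v2 : vertex (ordS (ordS k)) = vertex k + edge k + edge (ordS k).
    by rewrite !v1.
  rewrite /o v2 v1 eS; move: (vertex k) (edge k) => a e.
  apply: row2P; rewrite !mxE /=.
    transitivity (2^-1 * (a 0 0 + (a 0 0 + e 0 0)) + kappa * - e 0 1
      + (2^-1 * (1 + c) - s * kappa) * e 0 0
      + (kappa * (1 - c) - 2^-1 * s) * e 0 1); first by field.
    by rewrite sk kc; ring.
  transitivity (2^-1 * (a 0 1 + (a 0 1 + e 0 1)) + kappa * e 0 0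
      + (2^-1 * (1 + c) - s * kappa) * e 0 1
      - (kappa * (1 - c) - 2^-1 * s) * e 0 0); first by field.
  by rewrite sk kc; ring.
have o_const := ordS_invariant oS.
pose Q : 'M[R]_2 := \matrix_(i, j)
  (if i == j then c else if i == 0 then s else - s).
have QE u : u *m Q = c *: u + s *: rot u.
  by apply: row2P; rewrite mulmx2E !mxE /=; ring.
have Q1 : Q *m Q^T = 1%:M.
  by apply/orthogonal2P; rewrite !mxE /=; split; rewrite -?cs; ring.
have [n3 _] := conv.
pose k0 : 'I_(nb_sides p) := Ordinal (ltn_trans (ltn0Sn 1) n3).
(* The rotation by the exterior angle about the candidate center moves each vertex to the next. *)
have vS k : vertex k *m Q + (o k0 - o k0 *m Q) = vertex (ordS k).
  rewrite (o_const k0 k) !QE v1 /o v1; move: (vertex k) (edge k) => a e.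
  apply: row2P; rewrite !mxE /=.
    transitivity (a 0 0 + e 0 0
      - (2^-1 * (1 + c) - s * kappa) * e 0 0
      - (kappa * (1 - c) - 2^-1 * s) * e 0 1); first by field.
    by rewrite sk kc; ring.
  transitivity (a 0 1 + e 0 1
      - (2^-1 * (1 + c) - s * kappa) * e 0 1
      + (kappa * (1 - c) - 2^-1 * s) * e 0 0); first by field.
  by rewrite sk kc; ring.
(* This rotation only permutes the weights of a convex combination cyclically. *)
have inv : [set x *m Q + (o k0 - o k0 *m Q) | x in region p] = region p.
  have comb (w : 'I_(nb_sides p) -> R) : \sum_k w k = 1 ->
     (\sum_k w k *: vertex k) *m Q + (o k0 - o k0 *m Q) =
       \sum_k w (ord_pred k) *: vertex k.
    move=> w1; rewrite [RHS](reindex_inj (can_inj (@ordSK _))) /=.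
    rewrite mulmx_suml -[X in _ + X]scale1r -w1 scaler_suml -big_split/=.
    by apply: eq_bigr => k _; rewrite ordSK -vS [RHS]scalerDr scalemxAl.
  apply/seteqP; split=> [_ [_ [w [w0 w1 ->]] <-]|x [w [w0 w1 ->]]].
    rewrite comb//; exists (fun k => w (ord_pred k)); split=> //.
    by rewrite (reindex_inj (can_inj (@ordSK _))) -[RHS]w1;
      apply: eq_bigr => k _; rewrite ordSK.
  have w1' : \sum_k w (ordS k) = 1.
    by rewrite -w1 [RHS](reindex_inj (can_inj (@ordSK _))).
  exists (\sum_k w (ordS k) *: vertex k).
    by exists (fun k => w (ordS k)).
  by rewrite comb//; apply: eq_bigr => k _; rewrite ord_predK.
have := mass_center_isometry (o k0 - o k0 *m Q) (@region_compact _ p) _ Q1.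
rewrite inv gt_eqF => [/(_ isT)|]; last first.
  by apply: area_gt0; [exact: region_compact|exact: region_interior].
set m := mass_center _ => mE k; rewrite -/(o k) (o_const k k0).
(* The mass center is fixed by the rotation, so its offset from the candidate is too. The offset
   vanishes because [1 - Q] has determinant [(1 - c) ^+ 2 + s ^+ 2], which is positive. *)
have {}mE : (m - o k0) = (m - o k0) *m Q.
  by rewrite mulmxBl {1}mE addrA addrAC addrK.
apply/eqP; rewrite -subr_eq0; apply/eqP; move: mE; set d := m - _; clearbody d;
  rewrite QE => dE.
have d0 : (1 - c) * d 0 0 = - s * d 0 1.
  by have := congr1 (fun u : 'rV[R]_2 => u 0 0) dE; rewrite !mxE /=; lra.
have d1 : (1 - c) * d 0 1 = s * d 0 0.
  by have := congr1 (fun u : 'rV[R]_2 => u 0 1) dE; rewrite !mxE /=; lra.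
have nz : (1 - c) ^+ 2 + s ^+ 2 != 0.
  by rewrite gt_eqF// ltr_wpDl ?sqr_ge0// exprn_gt0.
apply: row2P; apply: (mulfI nz); rewrite mxE mulr0.
  transitivity ((1 - c) * ((1 - c) * d 0 0) + s * (s * d 0 0)); first by ring.
  by rewrite d0 -d1; ring.
transitivity ((1 - c) * ((1 - c) * d 0 1) + s * (s * d 0 1)); first by ring.
rewrite d1 -[s * d 0 1]opprK -mulNr -d0; ring.
Qed.

End Regular.
End RegularPolygons.

(** * Invariants of congruent regular polygons, and flux identities *)

Section CongruentPolygons.
Variable R : realType.
Implicit Types (u v x y n : 'rV[R]_2) (p q : polygon R).

(** Isometries carry exposed points to exposed points and supported pairs to supported pairs. The
    disjunction allows for reflections, which reverse the cyclic order. *)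
Lemma congruent_vertices p q (Q : 'M[R]_2) a :
  convex_polygon p -> convex_polygon q -> Q *m Q^T = 1%:M ->
  region q = [set x *m Q + a | x in region p] ->
  exists s : 'I_(nb_sides p) -> 'I_(nb_sides q),
    [/\ injective s, forall k, vertex (s k) = vertex k *m Q + a &
      forall k, s (ordS k) = ordS (s k) \/ s k = ordS (s (ordS k))].
Proof.
move=> cp cq Q1 qp.
have QI : injective (fun x : 'rV[R]_2 => x *m Q + a).
  by move=> x y /addIr xy; rewrite -[x]mulmx1 -[y]mulmx1 -Q1 !mulmxA xy.
have /choice[s sE] : forall k : 'I_(nb_sides p),
    exists j : 'I_(nb_sides q), vertex j = vertex k *m Q + a.
  move=> k; have := exposed_isometry a Q1 (vertex_exposed cp k).
  by rewrite -qp => /exposed_vertex[j ->]; exists j.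
have sI : injective s.
  by move=> k j skj; apply: (vertex_inj cp); apply: QI; rewrite -!sE skj.
exists s; split=> // k; apply: supported_side => //.
  by rewrite qp !sE; apply: supported_isometry => //; exact: side_supported.
by rewrite (inj_eq sI) ordS_neq.
Qed.

(** The isometry preserves side length and circumradius, and these determine [kappa]. Injectivity of
    the vertex map gives one inequality between the numbers of sides; exchanging [p] and [q] gives
    the other. *)
Lemma congruent_regular p q (kappa kappa' : R) :
  regular_polygon p -> regular_polygon q -> 0 < kappa -> 0 < kappa' ->
  (forall k : 'I_(nb_sides p), mass_center (region p) =
     midpoint k + kappa *: rot (edge k)) ->
  (forall k : 'I_(nb_sides q), mass_center (region q) =
     midpoint k + kappa' *: rot (edge k)) ->
  congruent (region p) (region q) ->
  [/\ (nb_sides p <= nb_sides q)%N, kappa = kappa', area (region p) = area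
    (region q) &
   forall (k : 'I_(nb_sides p)) (j : 'I_(nb_sides q)),
     dot (edge k) (edge k) = dot (edge j) (edge j)].
Proof.
move=> rp rq k0 k0' pE qE [Q [a [Q1 qp]]].
have [cp _ _] := rp; have [cq _ _] := rq.
have [s [sI sE sS]] := congruent_vertices cp cq Q1 qp.
have aE : area (region p) = area (region q).
  by rewrite qp area_isometry//; exact: region_closed.
have mE : mass_center (region q) = mass_center (region p) *m Q + a.
  rewrite qp mass_center_isometry//; first exact: region_compact.
  by rewrite gt_eqF// area_gt0//;
    [exact: region_compact|exact: region_interior].
have dE x y : dot (x *m Q + a - (y *m Q + a)) (x *m Q + a - (y *m Q + a)) =
  dot (x - y) (x - y).
  by rewrite opprD addrACA subrr addr0 -mulmxBl dot_isometry.
have [n3 _] := cp.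
pose i0 : 'I_(nb_sides p) := Ordinal (ltn_trans (ltn0Sn 1) n3).
have eE : dot (edge i0) (edge i0) = dot (edge (s i0)) (edge (s i0)).
  rewrite {1 2}/edge -dE -!sE.
  have [->//|sE0] := sS i0.
  rewrite (regular_edge rq (s i0) (s (ordS i0))) /edge -sE0 -opprB.
  by rewrite !dotE !mxE; ring.
(* The squared circumradius by Pythagoras: half a side and the apothem are the legs. *)
have radius r (kap : R) (k : 'I_(nb_sides r)) (c : 'rV[R]_2) :
    c = midpoint k + kap *: rot (edge k) ->
    dot (vertex k - c) (vertex k - c) =
      (4^-1 + kap ^+ 2) * dot (edge k) (edge k).
  move=> ->; rewrite /midpoint;
    have -> : vertex (ordS k) = vertex k + edge k by rewrite addrC subrK.
  by move: (vertex k) (edge k) => v e; rewrite !dotE !mxE /=; field.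
have kE : kappa ^+ 2 = kappa' ^+ 2.
  have e0 : dot (edge i0) (edge i0) != 0 by rewrite dot_eq0 edge_neq0.
  have := radius _ _ _ _ (qE (s i0));
    rewrite sE mE dE (radius _ _ _ _ (pE i0)) -eE.
  by move=> /(mulIf e0)/addrI.
split=> //.
- by rewrite -[leqLHS]card_ord -[leqRHS]card_ord; exact: leq_card sI.
- by apply/eqP; rewrite -(@eqrXn2 _ 2) ?ltW// kE.
- by move=> k j; rewrite (regular_edge rp k i0) eE (regular_edge rq (s i0) j).
Qed.

Lemma sum_edge p : \sum_k @edge R p k = 0.
Proof.
by rewrite sumrB [X in _ - X](reindex_inj (can_inj (@ordSK _)))/= subrr.
Qed.

Lemma rot0 : rot 0 = 0 :> 'rV[R]_2.
Proof. by apply: row2P; rewrite !mxE /= ?oppr0. Qed.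

Lemma rotD u v : rot (u + v) = rot u + rot v.
Proof. by apply: row2P; rewrite !mxE /=; ring. Qed.

Lemma sum_rot_edge p : \sum_k rot (@edge R p k) = 0.
Proof. by rewrite -(big_morph (@rot R) rotD rot0) sum_edge rot0. Qed.

(* The discrete divergence theorem for a linear field, from the shoelace
   formula [(u.b) rot a - (u.a) rot b = cross a b *: u]. *)
Lemma midpoint_flux p u :
  \sum_(k < nb_sides p) dot u (midpoint k) *: (- rot (edge k)) =
  (2^-1 * \sum_(k < nb_sides p) cross (vertex k) (vertex (ordS k))) *: u.
Proof.
pose F (k : 'I_(nb_sides p)) := (2^-1 * dot u (vertex k)) *: rot (vertex k).
rewrite (eq_bigr (fun k => (2^-1 * cross (vertex k) (vertex (ordS k))) *: u
    + (F k - F (ordS k)))); last first.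
  move=> k _; rewrite /midpoint /edge /F;
    move: (vertex k) (vertex (ordS k)) => a b.
  by apply: row2P; rewrite !dotE /cross !mxE /=; ring.
rewrite big_split/= sumrB [X in _ + (X - _)](reindex_inj (can_inj (@ordSK _)))/=.
by rewrite subrr addr0 -scaler_suml mulr_sumr.
Qed.

(** Replacing each midpoint by [o - kappa *: rot (edge k)] in [midpoint_flux] shows that the left
    side is a multiple of [u], since the terms with [o] sum to zero. The trace of this linear map
    gives the factor. *)
Lemma regular_flux p (kappa : R) o u : kappa != 0 ->
  (forall k : 'I_(nb_sides p),
     o = midpoint k + kappa *: rot (edge k)) ->
  \sum_(k < nb_sides p) dot u (rot (edge k)) *: rot (edge k) =
    (2^-1 * \sum_(k < nb_sides p) dot (edge k) (edge k)) *: u.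
Proof.
move=> k0 oE.
pose S : R := 2^-1 * \sum_(k < nb_sides p) cross (vertex k) (vertex (ordS k)).
have fl w : \sum_(k < nb_sides p) dot w (rot (edge k)) *: rot (edge k) =
  (S / kappa) *: w.
  apply: (scalerI k0); rewrite scalerA mulrCA divff// mulr1 -midpoint_flux.
  rewrite scaler_sumr.
  rewrite (eq_bigr (fun k => dot w (midpoint k) *: (- rot (edge k))
      + dot w o *: rot (edge k))); last first.
    move=> k _; rewrite [in dot w o](oE k) (dotDr w) (dotZr w (rot _)).
    by rewrite (scalerDl (rot _)) scalerN addKr scalerA.
  by rewrite big_split/= -scaler_sumr sum_rot_edge scaler0 addr0.
rewrite fl; congr (_ *: _).
pose e b : 'rV[R]_2 := delta_mx 0 b.
(* The diagonal entry [b] of the map; adding both entries gives the sum of the squared side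
   lengths. *)
have tr b : \sum_(k < nb_sides p) rot (edge k) 0 b ^+ 2 = S / kappa.
  have := congr1 (fun x : 'rV[R]_2 => x 0 b) (fl (e b)).
  rewrite summxE [RHS]mxE [e b 0 b]mxE !eqxx mulr1 => <-.
  apply: eq_bigr => k _; rewrite [RHS]mxE expr2; congr (_ * _).
  by rewrite dotE; have [->|->] := ord2P b;
    rewrite [e _ 0 0]mxE [e _ 0 1]mxE /= ?mulr1n ?mulr0n; ring.
apply: (@mulfI _ 2) => //; rewrite [RHS]mulrA divff// mul1r.
rewrite (_ : 2 * (S / kappa) = S / kappa + S / kappa); last by ring.
rewrite -{1}(tr 0) -(tr 1) -big_split; apply: eq_bigr => k _ /=.
by rewrite dotE ![rot _ _ _]mxE /=; ring.
Qed.

End CongruentPolygons.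

(** * Neighbors in a regular partition *)

Section Neighbors.
Variable R : realType.
Implicit Types (u v x y n : 'rV[R]_2) (p q : polygon R).

(** In the affine parameter along [c d], the points [a] and [b] sit at [t] and [s] in [[0, 1]],
    while [0] and [1] are convex combinations of [t] and [s]. So [t] and [s] are [0] and [1] in some
    order. *)
Lemma segment_endpoints (a b c d : 'rV[R]_2) : c != d ->
  segment a b = segment c d ->
  (a = c /\ b = d) \/ (a = d /\ b = c).
Proof.
move=> cd E.
have sl (x y : 'rV[R]_2) : segment x y x.
  by exists 0; rewrite ?lexx ?ler01// scale0r addr0.
have sr (x y : 'rV[R]_2) : segment x y y.
  by exists 1; rewrite ?lexx ?ler01// scale1r addrC subrK.
have [t /andP[t0 t1] at_] : segment c d a by rewrite -E.
have [s /andP[s0 s1] bs] : segment c d b by rewrite -E.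
have [r /andP[r0 r1] cr] : segment a b c by rewrite E.
have [q /andP[q0 q1] dq] : segment a b d by rewrite E.
have inj (z w : R) : c + z *: (d - c) = c + w *: (d - c) -> z = w.
  move=> /addrI/eqP; rewrite -subr_eq0 -scalerBl scaler_eq0 !subr_eq0.
  by rewrite [d == c]eq_sym (negbTE cd) orbF => /eqP.
have e (z : R) : a + z *: (b - a) = c + (t + z * (s - t)) *: (d - c).
  by rewrite at_ bs; apply: row2P; rewrite !mxE; ring.
have r_eq : 0 = t + r * (s - t) by apply: inj; rewrite -e -cr scale0r addr0.
have q_eq : 1 = t + q * (s - t) by apply: inj;
  rewrite -e -dq scale1r addrC subrK.
have [t00|tn0] := eqVneq t 0.
  left; have s1' : s = 1 by nra.
  by rewrite at_ bs t00 s1' scale0r addr0 scale1r addrC subrK.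
have tp : 0 < t by rewrite lt_def tn0.
right.
have s00 : s = 0 by nra.
have t11 : t = 1 by nra.
by rewrite at_ bs t11 s00 scale0r addr0 scale1r addrC subrK.
Qed.

Lemma midpoint_interior p (k : 'I_(nb_sides p)) : convex_polygon p ->
  exists2 e0 : R, 0 < e0 & forall e, 0 < e <= e0 ->
    (region p)° (midpoint k + e *: rot (edge k)).
Proof.
move=> cp; pose a := vertex k; pose b := vertex (ordS k);
  pose c := vertex (ordS (ordS k)).
have X0 := cp.2 k _ (ordSS_neq cp _) (ordS_neq cp _).
set X := cross _ _ in X0.
(* [Y] strictly bounds the rates at which the cross products with the other two sides of the
   triangle change along the inner normal; at the midpoint both equal [X / 2]. *)
pose Y := `|cross (c - b) (rot (b - a))| + `|cross (a - c) (rot (b - a))| + 1.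
have Y0 : 0 < Y by rewrite ltr_wpDl// addr_ge0.
exists (X / 4 / Y); first by rewrite !divr_gt0.
move=> e /andP[e0]; rewrite ler_pdivlMr// => eY.
have bnd (z : R) : `|z| < Y -> 0 < 2^-1 * X + e * z.
  move=> zY; have : - z < Y by apply: le_lt_trans zY; rewrite -normrN ler_norm.
  nra.
apply: (@triangle_interior _ _ a b c); try exact: vertex_region.
- rewrite (_ : cross _ _ = e * dot (b - a) (b - a)).
    by rewrite mulr_gt0// dot_gt0; exact: edge_neq0.
  by rewrite -/a -/b /midpoint /edge -/a -/b /cross dotE !mxE /=; field.
- rewrite (_ : cross _ _ = 2^-1 * X + e * cross (c - b) (rot (b - a))).
    by apply: bnd; rewrite /Y -addrA ltrDl ltr_wpDl.
  by rewrite /X /midpoint /edge -/a -/b -/c /cross !mxE /=; field.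
- rewrite (_ : cross _ _ = 2^-1 * X + e * cross (a - c) (rot (b - a))).
    by apply: bnd; rewrite /Y addrAC [ltRHS]addrC ltrDl ltr_wpDl.
  by rewrite /X /midpoint /edge -/a -/b -/c /cross !mxE /=; field.
Qed.

Lemma midpoint_outside p (k : 'I_(nb_sides p)) (e : R) : convex_polygon p ->
  0 < e -> ~ region p (midpoint k + e *: - rot (edge k)).
Proof.
move=> cp e0 /(region_left cp k); rewrite leNgt => /negP; apply.
rewrite (_ : cross _ _ = - (e * dot (edge k) (edge k))).
  by rewrite oppr_lt0 mulr_gt0// dot_gt0 edge_neq0.
have -> : midpoint k = vertex k + 2^-1 *: edge k.
  by rewrite /midpoint /edge; apply: row2P; rewrite !mxE; field.
by move: (vertex k) (edge k) => v w; rewrite /cross dotE !mxE /=; ring.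
Qed.

Lemma side_region p (k : 'I_(nb_sides p)) : side k `<=` region p.
Proof. by apply: segment_region; exact: vertex_region. Qed.

Lemma midpoint_side p (k : 'I_(nb_sides p)) : side k (midpoint k).
Proof.
exists 2^-1; first by apply/andP; split; lra.
by rewrite /midpoint; apply: row2P; rewrite !mxE; field.
Qed.

(** Both polygons are counterclockwise, so both lie to the left of the shared oriented edge and
    contain a common point slightly inside its midpoint. *)
Lemma same_edge_overlap p q (k : 'I_(nb_sides p)) (j : 'I_(nb_sides q)) :
  convex_polygon p -> convex_polygon q ->
  vertex k = vertex j -> vertex (ordS k) = vertex (ordS j) ->
  (region p)° `&` (region q)° !=set0.
Proof.
move=> cp cq vkj vSkj.
have [e e0 ep] := midpoint_interior k cp;
  have [e' e0' eq] := midpoint_interior j cq.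
exists (midpoint k + Num.min e e' *: rot (edge k)); split.
  by apply: ep; rewrite lt_min e0 e0' /= ge_min lexx.
have -> : midpoint k = midpoint j by rewrite /midpoint vkj vSkj.
have -> : edge k = edge j by rewrite /edge vkj vSkj.
by apply: eq; rewrite lt_min e0 e0' /= ge_min lexx orbT.
Qed.

Lemma vertex_on_side p (k j : 'I_(nb_sides p)) : convex_polygon p ->
  cross (edge k) (vertex j - vertex k) = 0 -> j = k \/ j = ordS k.
Proof.
move=> cp c0; have [->|jk] := eqVneq j k; first by left.
have [->|jSk] := eqVneq j (ordS k); first by right.
by have := cp.2 k j jk jSk; rewrite c0 ltxx.
Qed.

Lemma side_left0 p (k : 'I_(nb_sides p)) x : side k x ->
  cross (edge k) (x - vertex k) = 0.
Proof.
by move=> [t _ ->]; rewrite -/(edge k) addrC addKr /cross !mxE; ring.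
Qed.

(** The line of side [j] supports the polygon, so if it contains the midpoint of side [k] it
    contains both endpoints of that side. *)
Lemma midpoint_side_eq p (k j : 'I_(nb_sides p)) : convex_polygon p ->
  side j (midpoint k) -> k = j.
Proof.
move=> cp /side_left0 m0.
have k0 := cross_edge_ge0 cp j k; have Sk0 := cross_edge_ge0 cp j (ordS k).
have m2 : cross (edge j) (vertex k - vertex j) +
    cross (edge j) (vertex (ordS k) - vertex j) = 0.
  rewrite -[RHS](mulr0 2) -m0 /midpoint.
  by move: (vertex k) (vertex (ordS k)) (vertex j) (edge j) => a b c d;
    rewrite /cross !mxE; field.
have [//|kSj] : k = j \/ k = ordS j by apply: vertex_on_side => //; lra.
have [Skj|Skj] : ordS k = j \/ ordS k = ordS j by apply: vertex_on_side => //; lra.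
  by move: (ordSS_neq cp j); rewrite -kSj Skj eqxx.
exact: (can_inj (@ordSK _)) Skj.
Qed.

Lemma midpoint_vertex p (k j : 'I_(nb_sides p)) : convex_polygon p ->
  midpoint k <> vertex j.
Proof.
move=> cp mj.
have jk : j = k \/ j = ordS k.
  apply: vertex_on_side => //; rewrite -mj /midpoint /edge.
  by move: (vertex k) (vertex (ordS k)) => a b; rewrite /cross !mxE; field.
have /eqP := edge_neq0 cp k; apply; move: mj; rewrite /midpoint /edge.
by have [->|->] := jk; move: (vertex k) (vertex (ordS k)) => a b ab;
  apply: row2P;
  [have := congr1 (fun x : 'rV[R]_2 => x 0 0) ab|
   have := congr1 (fun x : 'rV[R]_2 => x 0 1) ab|
   have := congr1 (fun x : 'rV[R]_2 => x 0 0) ab|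
   have := congr1 (fun x : 'rV[R]_2 => x 0 1) ab]; rewrite !mxE; lra.
Qed.

Section Partition.
Variables (I : choiceType) (P : I -> polygon R).
Hypothesis hP : regular_partition P.

Let conv i : convex_polygon (P i). Proof. by case: hP => /(_ i)[]. Qed.

Lemma interior_eq i j : (region (P i))° `&` (region (P j))° !=set0 -> i = j.
Proof.
move=> /set0P; have [_ _ _ disj _] := hP.
by apply: contraNeq => /disj ->.
Qed.

(** Equal orientations are excluded because the interiors would overlap. *)
Lemma common_side_reversed i j (k : 'I_(nb_sides (P i)))
  (k' : 'I_(nb_sides (P j))) :
  i != j -> side k = side k' ->
  vertex k = vertex (ordS k') /\ vertex (ordS k) = vertex k'.
Proof.
move=> ij kk'.
have : vertex k' != vertex (ordS k').
  by apply/eqP => /(vertex_inj (conv j))/eqP;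
    rewrite eq_sym (negbTE (ordS_neq (conv j) k')).
move=> /segment_endpoints/(_ kk')[[v1 v2]|//].
have := interior_eq (same_edge_overlap (conv i) (conv j) v1 v2).
by move/eqP; rewrite (negbTE ij).
Qed.

(** The midpoints of both common sides lie in the intersection of the cells, which is a single side
    by [edge_to_edge]. *)
Lemma common_side_inj i j k1 k2 : i != j ->
  @common_side _ _ P i j k1 -> @common_side _ _ P i j k2 -> k1 = k2.
Proof.
move=> ij [k1' s1] [k2' s2].
have inter (k : 'I_(nb_sides (P i))) (k' : 'I_(nb_sides (P j))) :
    side k = side k' -> (region (P i) `&` region (P j)) (midpoint k).
  move=> kk'; split; first exact: (side_region (midpoint_side k)).
  by apply: (@side_region _ k'); rewrite -kk'; exact: midpoint_side.
have m1 := inter _ _ s1; have m2 := inter _ _ s2.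
have [_ _ _ _ e2e] := hP.
have [E|[k [k' [_ E]]]|[k [k' [_ E]]]] := e2e i j ij; rewrite E in m1 m2.
- by [].
- by case: (@midpoint_vertex _ k1 k (conv i)).
- by rewrite (midpoint_side_eq (conv i) m1) (midpoint_side_eq (conv i) m2).
Qed.

(** Both neighbors traverse the side against the orientation of cell [i], hence in the same
    direction, so they overlap. *)
Lemma common_side_neighbor_inj i j j' k : i != j -> i != j' ->
  @common_side _ _ P i j k -> @common_side _ _ P i j' k -> j = j'.
Proof.
move=> ij ij' [k1 s1] [k2 s2].
have [v1 v1'] := common_side_reversed ij s1.
have [v2 v2'] := common_side_reversed ij' s2.
apply: interior_eq; apply: (@same_edge_overlap _ _ k1 k2) => //.
  by rewrite -v1' v2'.
by rewrite -v1 v2.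
Qed.

(* Local finiteness enters here: cells reached by points of the ray that tend to
   [m] cannot be pairwise distinct. *)
Lemma cell_near_ray i m u :
  (forall t : R, 0 < t -> ~ region (P i) (m + t *: u)) ->
  exists2 j, i != j & region (P j) m.
Proof.
move=> out; have [_ cong cover _ _] := hP.
(* [J t] is a cell that contains the point of the ray with parameter [t]. *)
have /choice[J JP] (t : R) : exists j, region (P j) (m + t *: u).
  have : (\bigcup_i region (P i)) (m + t *: u) by rewrite cover.
  by case=> j _; exists j.
have /choice[Qa QaP] j : exists Qa : 'M[R]_2 * 'rV[R]_2,
    Qa.1 *m Qa.1^T = 1%:M /\ region (P j) =
      [set x *m Qa.1 + Qa.2 | x in region (P i)].
  by have [Q [a Qa]] := cong i j; exists (Q, a).
have [q /nbhs_ballP[r /= r0 qr]] := region_interior (conv i).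
have [M M0 iM] := compact_coord_bounded (@region_compact _ (P i)).
pose c j := q *m (Qa j).1 + (Qa j).2.
have Q_le1 j b b' : `|(Qa j).1 b b'| <= 1.
  have [/orthogonal2P[Q0 Q1 _] _] := QaP j.
  rewrite -(@ler_pXn2r _ 2) ?nnegrE// expr1n real_normK ?num_real//.
  have [->|->] := ord2P b; have [->|->] := ord2P b'.
  - by rewrite -Q0 lerDl sqr_ge0.
  - by rewrite -Q0 lerDr sqr_ge0.
  - by rewrite -Q1 lerDl sqr_ge0.
  - by rewrite -Q1 lerDr sqr_ge0.
have r20 : 0 < r / 2 by rewrite divr_gt0.
(* Every cell contains the same small ball around its copy of [q], so that the
   copies of [q] in distinct cells are uniformly separated. *)
have c_ball j : ball (c j) (r / 2) `<=` region (P j).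
  move=> y [_ yc]; have [Q1 ->] := QaP j; set Q := (Qa j).1; set a := (Qa j).2.
  have QQ : Q^T *m Q = 1%:M by exact: mulmx1C.
  exists (q + (y - c j) *m Q^T); last first.
    by rewrite mulmxDl -mulmxA QQ mulmx1 /c -/Q -/a addrAC addrC subrK.
  have yc' b : `|(y - c j) 0 b| < r / 2.
    by have := yc 0 b; rewrite [X in _ -> `|X| < _]mxE
      [X in _ -> `|_ + X| < _]mxE distrC.
  apply: qr; split=> // b b'; rewrite ord1 {b}.
  rewrite /ball/= mxE opprD addNKr normrN mulmx2E ![Q^T _ _]mxE.
  (* The sup norm is not invariant under rotations: each coordinate is a sum of two terms below
     [r / 2], whence the halved radius. *)
  apply: le_lt_trans (ler_normD _ _) _; rewrite !normrM [ltRHS]splitr.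
  by apply: ltrD; apply: le_lt_trans (ler_wpM2l (normr_ge0 _) (Q_le1 _ _ _)) _;
    rewrite mulr1.
have c_sep j j' : ball (c j) (r / 2) (c j') -> j = j'.
  move=> cjj'; apply: interior_eq; exists (c j'); split.
    move: (c_ball j); rewrite open_subsetE; last exact: ball_open.
    by apply.
  by apply: filterS (c_ball j') _; exact: nbhsx_ballx.
(* A bound for all copies of [q] with [0 < t < 1]: coordinates within a cell differ by at most
   [2 * M], and the matrix product adds two of them. *)
pose K := M * 4 + `|m 0 0| + `|m 0 1| + `|u 0 0| + `|u 0 1|.
pose box : set 'rV[R]_2 := [set w | forall b, `[- K, K]%classic (w ord0 b)].
have cbox : compact box.
  by apply: (@rV_compact R _ (fun=> `[- K, K]%classic)) => _;
    exact: segment_compact.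
have c_box t : 0 < t < 1 -> box (c (J t)).
  move=> /andP[t0 t1] b; rewrite /= in_itv/= -ler_norml.
  have := JP t; have [Q1 ->] := QaP (J t) => -[y iy yE].
  rewrite (_ : c (J t) = (q - y) *m (Qa (J t)).1 + (m + t *: u)); last first.
    by rewrite -yE mulmxBl addrA subrK.
  have d b' : `|(q - y) 0 b'| <= M + M.
    rewrite mxE [X in _ + X]mxE; apply: le_trans (ler_normB _ _) _.
    by rewrite lerD// iM//; apply: qr; exact: ballxx.
  have two_coords (w : 'rV[R]_2) : `|w 0 b| <= `|w 0 0| + `|w 0 1|.
    by have [->|->] := ord2P b; rewrite ?lerDl ?lerDr.
  have dQ b' : `|(q - y) 0 b' * (Qa (J t)).1 b' b| <= M + M.
    rewrite normrM; apply: le_trans (d b').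
    by rewrite -[leRHS]mulr1 ler_wpM2l.
  have tu : `|t * u 0 b| <= `|u 0 0| + `|u 0 1|.
    apply: le_trans (two_coords u); rewrite normrM -[leRHS]mul1r ler_wpM2r//.
    by rewrite ger0_norm ltW.
  rewrite mxE mulmx2E [X in _ + X]mxE [X in _ + (_ + X)]mxE.
  apply: le_trans (ler_normD _ _) _; 
  apply: (@le_trans _ _
    (M * 4 + ((`|m 0 0| + `|m 0 1|) + (`|u 0 0| + `|u 0 1|)))).
    apply: lerD; apply: le_trans (ler_normD _ _) _; last exact: lerD.
    by have := dQ 0; have := dQ 1; lra.
  by rewrite /K; lra.
(* By compactness the copies of [q] in the cells [J t] cluster as [t] tends to [0] from the
   right. *)
pose F : set_system 'rV[R]_2 := (fun t => c (J t)) @ 0^'+.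
have Fbox : F box.
  have : \forall t \near (0 : R)^'+, box (c (J t)).
    near=> t; apply: c_box; apply/andP; split.
      by near: t; exact: nbhs_right_gt.
    by near: t; exact: nbhs_right_lt.
  by [].
have [cs [_ clus]] : box `&` cluster F !=set0 by exact: cbox.
pose V := ball cs (r / 4).
have nV : nbhs cs V by apply: nbhsx_ballx; rewrite divr_gt0.
(* Near the cluster point there is room for the copy of [q] of one cell only. *)
have V_sep j j' : V (c j) -> V (c j') -> j = j'.
  move=> Vj Vj'; apply: c_sep.
  have : ball (c j) (r / 4 + r / 4) (c j') by apply: ball_triangle Vj';
    exact: ball_sym.
  by rewrite (_ : r / 4 + r / 4 = r / 2); last by field.
have hit (W : set R) : 0^'+ W -> exists2 t, W t & V (c (J t)).
  move=> FW; have [|_ [[t Wt <-] Vt]] := clus ((fun t => c (J t)) @` W) V _ nV.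
    by apply: filterS FW => t Wt; exists t.
  by exists t.
have ray_m : (fun t : R => m + t *: u) @ 0^'+ --> m.
  have ray_cont : continuous (fun t : R => m + t *: u).
    apply: continuous_row2 => b.
    rewrite (_ : (fun _ => _) = (fun t : R => m 0 b + t * u 0 b)).
      by move=> t; apply: cvgD;
        [exact: cvg_cst|apply: cvgMr_tmp; exact: cvg_id].
    by apply/funext => t; rewrite !mxE.
  apply: cvg_at_right_filter; have := ray_cont 0;
    rewrite /continuous_at scale0r addr0; exact.
(* So one cell contains points of the ray arbitrarily close to [m], and being closed it contains
   [m]. *)
have [t0 t0gt Vt0] := hit _ (nbhs_right_gt 0).
exists (J t0); last first.
  apply: (@region_closed _ (P (J t0))) => B nB.
  have [t Bt Vt] : exists2 t, B (m + t *: u) & V (c (J t)).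
    apply: hit; apply: ray_m; exact: nB.
  by exists (m + t *: u); split=> //; rewrite (V_sep _ _ Vt0 Vt).
apply/eqP => it0; apply: (out t0 t0gt); rewrite it0; exact: JP.
Unshelve. all: by end_near.
Qed.

(** The outward ray from the midpoint avoids cell [i], so another cell contains the midpoint;
    [edge_to_edge] then makes the intersection the whole side. *)
Lemma common_side_exists i (k : 'I_(nb_sides (P i))) :
  exists2 j, i != j & @common_side _ _ P i j k.
Proof.
have [j ij jm] : exists2 j, i != j & region (P j) (midpoint k).
  by apply: cell_near_ray => t t0; exact: midpoint_outside.
exists j => //.
have m : (region (P i) `&` region (P j)) (midpoint k).
  by split=> //; exact: (side_region (midpoint_side k)).
have [_ _ _ _ e2e] := hP.
have [E|[k1 [k' [_ E]]]|[k1 [k' [s E]]]] := e2e i j ij; rewrite E in m.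
- by [].
- by case: (@midpoint_vertex _ k k1 (conv i)).
- by exists k'; rewrite -s (midpoint_side_eq (conv i) m).
Qed.

End Partition.
End Neighbors.

(** * Lengths, normals and centers across common sides *)

Section Interfaces.
Variable R : realType.
Variables (I : choiceType) (P : I -> polygon R).
Hypothesis hP : regular_partition P.

Let reg i : regular_polygon (P i). Proof. by case: hP. Qed.
Let conv i : convex_polygon (P i). Proof. by case: (reg i). Qed.

Lemma edge_common_side_reversed i j (k : 'I_(nb_sides (P i)))
  (k' : 'I_(nb_sides (P j))) :
  i != j -> side k = side k' -> edge k = - edge k'.
Proof.
by move=> ij /(common_side_reversed hP ij)[v1 v2]; rewrite /edge v1 v2 opprB.
Qed.

Lemma side_lengthE i j (k : 'I_(nb_sides (P i))) :
  @common_side _ _ P i j k -> side_length P i j = enorm (edge k).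
Proof.
move=> c; rewrite /side_length.
have [k2 _ ->] := @getPex _
  [set l | exists2 k, @common_side _ _ P i j k & l = enorm (edge k)]
  (ex_intro _ (enorm (edge k)) (ex_intro2 _ _ k c erefl)).
exact: regular_enorm.
Qed.

(** Orthogonality and unit length leave two opposite vectors. A vertex of cell [j] off the common
    side decides the sign, so [get] can only return the outer normal of cell [i]. *)
Lemma side_normalE i j (k : 'I_(nb_sides (P i))) : i != j ->
  @common_side _ _ P i j k ->
  side_normal P i j = - (enorm (edge k))^-1 *: rot (edge k).
Proof.
move=> ij c; rewrite /side_normal; set S := [set n | _].
have [k' kk'] := c.
have [v1 v2] := common_side_reversed hP ij kk'.
have ee := edge_common_side_reversed ij kk'.
have l0 : 0 < enorm (edge k) by rewrite enorm_gt0 edge_neq0.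
have l2 := enorm_sqr (edge k).
set e := edge k in l0 l2 ee *; set l := enorm e in l0 l2 *.
have ek' : edge k' = - e by rewrite ee opprK.
have vS : vertex (ordS k') = vertex k' - e by rewrite -ek' /edge addrC subrK.
have ln : l != 0 by rewrite gt_eqF.
have S_n : S (- l^-1 *: rot e).
  exists k => //; split.
  - rewrite /enorm (_ : dot _ _ = 1) ?sqrtr1//.
    transitivity (l ^- 2 * dot e e); first by rewrite !dotE !mxE /=; field.
    by rewrite -l2 mulVf// expf_neq0.
  - by rewrite dotE !mxE /=; ring.
  - move=> y /(region_left (conv j) k'); rewrite ek' => h.
    rewrite dotZl dot_rot v1 vS mulNr oppr_ge0 pmulr_rle0 ?invr_gt0//.
    move: h; rewrite /cross; move: (vertex k') => w; rewrite !mxE; lra.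
have [k2 c2 [n1 n2 n3]] := @getPex _ S (ex_intro _ _ S_n).
move: n1 n2 n3; rewrite (common_side_inj hP ij c2 c) -/e.
set n := get S => n1 n2 n3.
have nn : dot n n = 1 by rewrite -enorm_sqr n1 expr1n.
have nE : l ^+ 2 *: n = cross e n *: rot e.
  transitivity (dot n e *: e + cross e n *: rot e);
    last by rewrite n2 scale0r add0r.
  by rewrite l2; apply: row2P; rewrite !dotE /cross !mxE /=; ring.
have cr : cross e n ^+ 2 = l ^+ 2.
  have := lagrange n e; rewrite n2 nn -l2 mul1r => <-.
  by rewrite /cross; ring.
have cr_le0 : cross e n <= 0.
  have pos : cross e (vertex (ordS (ordS k')) - vertex k) < 0.
    have := (conv j).2 k' _ (ordSS_neq (conv j) _) (ordS_neq (conv j) _).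
    rewrite v1 vS ek'; move: (vertex _) (vertex k') => a b.
    by rewrite /cross !mxE; lra.
  have := n3 _ (vertex_region (ordS (ordS k'))).
  rewrite -(pmulr_rge0 _ (exprn_gt0 2 l0)) -dotZl nE dotZl dot_rot.
  by rewrite nmulr_lge0.
have crE : cross e n = - l.
  have /eqP := cr; rewrite eqf_sqr => /orP[/eqP cl|/eqP//].
  by move: cr_le0; rewrite cl leNgt l0.
apply: (scalerI (expf_neq0 2 ln)); rewrite nE crE scalerA; congr (_ *: _).
by field.
Qed.

(** Taking the neighbor across each side is a bijection, which turns sums over neighbors into sums
    over sides. *)
Lemma neighborsP i : exists nb : 'I_(nb_sides (P i)) -> I,
  (forall k, i != nb k /\ @common_side _ _ P i (nb k) k) /\
  (forall F : I -> R, \sum_(j \in neighbors P i) F j = \sum_k F (nb k)).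
Proof.
have /choice[nb nbP] (k : 'I_(nb_sides (P i))) :
    exists j, i != j /\ @common_side _ _ P i j k.
  by have [j ij kj] := common_side_exists hP k; exists j.
exists nb; split=> // F.
have nb_inj : injective nb.
  move=> k k' kk'; have [ik ck] := nbP k; have [ik' ck'] := nbP k'.
  by apply: (common_side_inj hP ik ck); rewrite kk'.
have -> : neighbors P i = [set nb k | k in [set: 'I_(nb_sides (P i))]].
  apply/seteqP; split=> [j [ji [k c]]|_ [k _ <-]]; last first.
    by have [ik ck] := nbP k; split; [rewrite eq_sym|exists k].
  exists k => //; have [ik ck] := nbP k.
  by apply: (common_side_neighbor_inj hP ik _ ck c); rewrite eq_sym.
rewrite fsbig_image; last by move=> k k' _ _; exact: nb_inj.
have -> : [set: 'I_(nb_sides (P i))] = [set` enum 'I_(nb_sides (P i))].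
  by apply/seteqP; split=> k //= _; rewrite mem_enum.
by rewrite -fsbig_seq ?enum_uniq// big_enum.
Qed.

(** Congruence gives one [kappa] for all cells. Across a common side the midpoints agree and the
    edges are opposite, so the two centers are mirror images. *)
Lemma cell_center_neighbor : exists2 kappa : R, 0 < kappa &
  [/\ forall i (k : 'I_(nb_sides (P i))), cell_center P i = midpoint k + kappa
    *: rot (edge k),
   forall i j, i != j ->
     forall k : 'I_(nb_sides (P i)), @common_side _ _ P i j k ->
     cell_center P j - cell_center P i = - (2 * kappa) *: rot (edge k) &
   forall i j, cell_area P i = cell_area P j /\
     \sum_(k < nb_sides (P i)) dot (edge k) (edge k) =
       \sum_(k < nb_sides (P j)) dot (edge k) (edge k)].
Proof.
(* A reference cell exists because the cells cover the plane. *)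
have [i0 _ _] : (\bigcup_i region (P i)) 0 by have [_ _ -> _ _] := hP.
have [kappa k0 cE0] := regular_center (reg i0).
have cong i j : congruent (region (P i)) (region (P j)) by case: hP.
have cE i (k : 'I_(nb_sides (P i))) : cell_center P i =
  midpoint k + kappa *: rot (edge k).
  have [kappa' k0' cE] := regular_center (reg i).
  have [_ -> _ _] := congruent_regular (reg i0) (reg i) k0 k0' cE0 cE
    (cong i0 i).
  exact: cE.
exists kappa => //; split=> [//|i j ij k [k' kk']|i j].
- rewrite (cE i k) (cE j k').
  have [v1 v2] := common_side_reversed hP ij kk'.
  rewrite /midpoint /edge v1 v2.
  by move: (vertex k') (vertex (ordS k')) => a b; apply: row2P; rewrite !mxE /=;
    ring.
- have [ij _ aE eE] := congruent_regular (reg i) (reg j) k0 k0 (cE i) (cE j)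
    (cong i j).
  have [ji _ _ _] := congruent_regular (reg j) (reg i) k0 k0 (cE j) (cE i)
    (cong j i).
  split=> //; have nE : nb_sides (P i) = nb_sides (P j) by apply/eqP;
    rewrite eqn_leq ij ji.
  have [n3 _] := conv j;
    pose k1 : 'I_(nb_sides (P j)) := Ordinal (ltn_trans (ltn0Sn 1) n3).
  rewrite (eq_bigr (fun=> dot (edge k1) (edge k1))) => [|k _]; last exact: eE.
  rewrite [RHS](eq_bigr (fun=> dot (edge k1) (edge k1))) => [|k _];
    last exact: (regular_edge (reg j)).
  by rewrite !sumr_const !card_ord nE.
Qed.

End Interfaces.

(** * Fluxes of a uniform state *)

Section UniformState.
Variable R : realType.
Variables (I : choiceType) (P : I -> polygon R) (theta : I -> R) (theta0 h : R).
Hypothesis hP : regular_partition P.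
Hypothesis htheta : forall i, theta i = theta0.
Implicit Types (v : 'rV[R]_2) (i j : I).

Let reg i : regular_polygon (P i). Proof. by case: hP. Qed.
Let conv i : convex_polygon (P i). Proof. by case: (reg i). Qed.

Lemma theta_h_uniform v i j :
  theta_h P theta (fun=> h) (fun=> v) i j * normal_velocity P (fun=> v) i j =
  theta0 * h * normal_velocity P (fun=> v) i j.
Proof.
rewrite /theta_h !htheta; case: ltgtP => // <-.
by rewrite !mulr0.
Qed.

Lemma theta_hs_uniform (g : R) (z : I -> R) v i j :
  theta_hs P g theta z (fun=> h) (fun=> v) i j = theta0 * h.
Proof.
by rewrite /theta_hs /theta_h !htheta; case: ltgtP => //= _; case: ifP.
Qed.

Lemma interface_velocity_uniform v i j : interface_velocity (fun=> v) i j = v.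
Proof. by rewrite /interface_velocity; apply: row2P; rewrite !mxE; field. Qed.

(** The side length cancels the normalisation of the normal, and the rotated edges sum to zero. *)
Lemma mass_flux_uniform v i : mass_flux P theta (fun=> h) (fun=> v) i = 0.
Proof.
have [nb [nbP nb_sum]] := neighborsP hP i; rewrite /mass_flux nb_sum.
rewrite (eq_bigr (fun k => dot (- (theta0 * h) *: v) (rot (edge k))));
  last first.
  move=> k _; have [ik ck] := nbP k.
  rewrite -mulrA theta_h_uniform /normal_velocity interface_velocity_uniform.
  rewrite (side_lengthE hP ck) (side_normalE hP ik ck) dotZr dotZl.
  by field; rewrite gt_eqF// enorm_gt0 edge_neq0.
by rewrite -dot_sumr sum_rot_edge dotE !mxE !mulr0 addr0.
Qed.

Lemma momentum_flux_uniform v a i :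
  momentum_flux P theta (fun=> h) (fun=> v) a i = 0.
Proof.
have [nb [nbP nb_sum]] := neighborsP hP i.
transitivity (v 0 a * mass_flux P theta (fun=> h) (fun=> v) i); last first.
  by rewrite mass_flux_uniform mulr0.
rewrite /momentum_flux /mass_flux !nb_sum mulr_sumr; apply: eq_bigr => k _.
by rewrite interface_velocity_uniform; ring.
Qed.

(** The constant depth drops out of the level differences. The minus signs of the center offset and
    of the outer normal cancel, leaving the sum evaluated by [regular_flux]. *)
Lemma pressure_term_uniform (g kappa z0 : R) (z : I -> R) (xi : 'rV[R]_2) v a i
  :
  kappa != 0 ->
  (forall i (k : 'I_(nb_sides (P i))), cell_center P i = midpoint k + kappa *:
    rot (edge k)) ->
  (forall i j, i != j -> forall k : 'I_(nb_sides (P i)), @common_side _ _ P i j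
    k ->
     cell_center P j - cell_center P i = - (2 * kappa) *: rot (edge k)) ->
  (forall i, z i - z0 = dot xi (cell_center P i)) ->
  pressure_term P g theta z (fun=> h) (fun=> v) a i =
    g * theta0 * h * kappa *
      (2^-1 * \sum_(k < nb_sides (P i)) dot (edge k) (edge k)) * xi 0 a.
Proof.
move=> k0 cE cB zE; have [nb [nbP nb_sum]] := neighborsP hP i.
rewrite /pressure_term nb_sum.
have fl := regular_flux xi k0 (cE i).
have := congr1 (fun w : 'rV[R]_2 => w 0 a) fl; rewrite summxE [RHS]mxE => flE.
rewrite -[RHS]mulrA -flE !mulr_sumr; apply: eq_bigr => k _.
have [ik ck] := nbP k.
rewrite theta_hs_uniform (side_lengthE hP ck) (side_normalE hP ik ck).
have -> : level g z (fun=> h) (nb k) - level g z (fun=> h) i =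
    - (2 * kappa * g) * dot xi (rot (edge k)).
  rewrite /level (_ : _ - _ = g * ((z (nb k) - z0) - (z i - z0))); last by ring.
  by rewrite !zE -dotBr (cB _ _ ik _ ck) dotZr; ring.
have l0 : enorm (edge k) != 0 by rewrite gt_eqF// enorm_gt0 edge_neq0.
by move: (rot (edge k)) (enorm (edge k)) l0 => r l l0; rewrite !mxE; field.
Qed.

End UniformState.

(** * The velocity at which friction balances the slope *)

Theorem proposition4p3 (R : realType) (I : choiceType) (P : I -> polygon R)
    (g alpha_p alpha_s : R) (theta z : I -> R)
    (z0 : R) (xi : 'rV[R]_2) (theta0 : R)
    (hP : regular_partition P)
    (hg : 0 < g) (hap : 0 < alpha_p) (has : 0 < alpha_s)
    (htheta01 : forall i, 0 < theta i <= 1)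
    (htheta : forall i, theta i = theta0)
    (hz : forall i, z i - z0 = \sum_(b < 2) xi 0 b * cell_center P i 0 b) :
  forall h : R, 0 < h ->
    exists v : 'rV[R]_2,
      stationary_point P g alpha_p alpha_s theta z (fun _ => h) (fun _ => v).
Proof.
move=> h h0.
have [i0 _ _] : (\bigcup_i region (P i)) 0 by have [_ _ -> _ _] := hP.
have [kappa k0 [cE cB same]] := cell_center_neighbor hP.
have kn : kappa != 0 by rewrite gt_eqF.
have /andP[th0 th1] : 0 < theta0 <= 1 by rewrite -(htheta i0).
pose T i := 2^-1 * \sum_(k < nb_sides (P i)) dot (edge k) (edge k).
pose K := friction alpha_p alpha_s h theta0.
have K0 : 0 < K.
  by rewrite /K /friction ltr_wpDl ?mulr_gt0// !mulr_ge0 ?subr_ge0// ltW.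
have sigma0 : 0 < cell_area P i0.
  apply: area_gt0; first exact: region_compact.
  by apply: region_interior; case: hP => /(_ i0)[].
have T0 i : 0 <= T i.
  by rewrite mulr_ge0 ?invr_ge0// sumr_ge0// => k _; exact: dot_ge0.
have TE i : T i = T i0 by rewrite /T (same i i0).2.
(* The pressure term is [A *: xi] in every cell. For the velocity [- c *: xi] with [c >= 0], the
   friction side is [c ^+ 2] times [cell_area P i0 * K * enorm xi] times [xi], which dictates
   [c]. *)
pose A := g * theta0 * h * kappa * T i0.
have A0 : 0 <= A by rewrite /A mulr_ge0
  ?(ltW (mulr_gt0 (mulr_gt0 (mulr_gt0 hg th0) h0) k0))//.
(* When [xi = 0], the division by zero gives [c = 0]. *)
pose c := Num.sqrt (A / (cell_area P i0 * K * enorm xi)).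
exists (- c *: xi) => t i; split; first exact: derivable_cst.
  by rewrite (mass_flux_uniform h hP htheta) derive1_cst mulr0 addr0.
move=> a; split; first exact: derivable_cst.
rewrite derive1_cst mulr0 add0r (momentum_flux_uniform h hP htheta) add0r.
rewrite (pressure_term_uniform h hP htheta _ _ _ _ kn cE cB hz).
rewrite -/(T i) TE -/A (same i i0).1 htheta -/K.
have [x0|xn0] := eqVneq xi 0; first by rewrite x0 !mxE !mulr0 oppr0.
have e0 : 0 < enorm xi by rewrite enorm_gt0.
have c2 : c ^+ 2 = A / (cell_area P i0 * K * enorm xi).
  by rewrite sqr_sqrtr// divr_ge0// ltW// !mulr_gt0.
have -> : enorm (- c *: xi) = c * enorm xi.
  rewrite /enorm dotZl dotZr mulrA mulrNN -expr2 sqrtrM ?sqr_ge0// sqrtr_sqr.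
  by rewrite ger0_norm// sqrtr_ge0.
rewrite mxE.
transitivity (cell_area P i0 * K * enorm xi * c ^+ 2 * xi 0 a); last by ring.
by rewrite c2; field; rewrite !gt_eqF.
Qed.
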